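(* Let $k\ge 1$ and let $\underline{T}=(T_1,\dots,T_k)$ be a $q$-commuting tuple of contractions on $\mathbb{C}^2$, with $q=\{q_{ij}\}$. If $\underline{T}$ is unitarily equivalent to a $q$-commuting tuple of contractions on $\mathbb{C}^2$ that is of Type-$I$, Type-$II$ or Type-$III$, then $\underline{T}$ admits a $\widetilde{q}$-unitary dilation for some family $\widetilde{q}$ with $\widetilde{q}\subseteq q\cup\{1\}$. That is, there exist a family $\widetilde q=\{\widetilde q_{ij}\}$ of unimodular scalars with $\widetilde{q}\subseteq q\cup\{1\}$, a Hilbert space $\mathcal{K}$, a $\widetilde q$-commuting tuple of unitaries $(U_1,\dots,U_k)$ on $\mathcal{K}$, and an isometry $V:\mathbb{C}^2\to\mathcal{K}$ such that $T_1^{m_1}\cdots T_k^{m_k}=V^*U_1^{m_1}\cdots U_k^{m_k}V$ for all non-negative integers $m_1,\dots,m_k$.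
   Context: A tuple $\underline{T}=(T_1,\dots,T_k)$ of bounded operators on a complex Hilbert space is $q$-commuting if $q=\{q_{ij}\in\mathbb{C}: |q_{ij}|=1,\ q_{ij}=q_{ji}^{-1},\ 1\le i<j\le k\}$ is a family of unimodular scalars with $T_iT_j=q_{ij}T_jT_i$ for $1\le i<j\le k$. A contraction is an operator of norm at most $1$. $\mathbb{T}$ is the unit circle. Tuples $(A_1,\dots,A_k)$ and $(B_1,\dots,B_k)$ on $\mathbb{C}^2$ are unitarily equivalent if there is a unitary $W$ with $W^*A_jW=B_j$ for all $j$. The inclusion $\widetilde q\subseteq q\cup\{1\}$ is an inclusion of sets of scalars. For a tuple $(T_1,\dots,T_k)$ and $\alpha\in\mathbb{C}$ put $\eta_\alpha=\{i: 1\le i\le k,\ T_1T_i=\alpha T_iT_1\}$. A $q$-commuting tuple of $2\times2$ matrices $(T_1,\dots,T_k)$ is: - of Type-$I$ if $T_1=\begin{pmatrix} a & 0 \\ 0 & ra \end{pmatrix}$ with $a\neq0$, $r\in\mathbb{T}\setminus\{\pm1\}$, $q_{1j}\in\{1,r\}$ for $2\le j\le k$, and for $2\le j\le k$: $T_j=\begin{pmatrix} c_j & 0 \\ 0 & f_j \end{pmatrix}$ with $|c_j|=|f_j|\ne0$ if $j\in\eta_1$, and $T_j=\begin{pmatrix} 0 & 0 \\ {e_j} & 0 \end{pmatrix}$ with $e_j\neq0$ if $j\in\eta_r$; - of Type-$II$ if $T_1=\begin{pmatrix} a & 0 \\ 0 & ra \end{pmatrix}$ with $a\neq0$, $r\in\mathbb{T}\setminus\{\pm1\}$,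 $q_{1j}\in\{1,\overline r\}$ for $2\le j\le k$, and for $2\le j\le k$: $T_j=\begin{pmatrix} c_j & 0 \\ 0 & f_j \end{pmatrix}$ with $|c_j|=|f_j|\ne0$ if $j\in\eta_1$, and $T_j=\begin{pmatrix} 0 & d_j \\ 0 & 0 \end{pmatrix}$ with $d_j\neq0$ if $j\in\eta_{\overline r}$; - of Type-$III$ if $T_1=\begin{pmatrix} a & 0 \\ 0 & -a \end{pmatrix}$ with $a\neq0$, $q_{1j}\in\{1,-1\}$ for $2\le j\le k$, and for $2\le j\le k$: $T_j=\begin{pmatrix} c_j & 0 \\ 0 & \pm c_j \end{pmatrix}$ with $c_j\ne0$ if $j\in\eta_1$, and $T_j=\begin{pmatrix} 0 & d_j \\ {e_j} & 0 \end{pmatrix}$ with $d_j\neq0$ or $e_j\ne0$ if $j\in\eta_{-1}$. *)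

(* Defs.v *)
From HB Require Import structures.
From mathcomp Require Import all_boot all_order all_algebra.
From mathcomp Require Import complex.
From mathcomp Require Import all_classical all_reals all_analysis.
Set Implicit Arguments.
Unset Strict Implicit.
Unset Printing Implicit Defensive.
Import Order.TTheory GRing.Theory Num.Theory.
Import numFieldNormedType.Exports.
Local Open Scope ring_scope.
Local Open Scope sesquilinear_scope.
Local Open Scope complex_scope.

(* Throughout, R is an arbitrary model of the real numbers, R[i] is the field
   of complex numbers, and tuples indexed by 1, ..., k are functions on 'I_k
   (so the first entry of a nonempty tuple has index ord0). *)

(* A complete normed module over R[i] whose norm comes from an inner product
   that is linear in its first argument. *)
Record hilbertType (R : realType) := Hilbert {
  hilbert_sort :> completeNormedModType R[i];
  hdot : {dot hilbert_sort for Num.conj};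
  hdot_norm : forall x : hilbert_sort, hdot x x = `|x| ^+ 2 }.

Section EuclideanSpace.
Variables (R : realType) (n : nat).

(* The norm that the library puts on matrices is the max norm, hence this
   separate Euclidean structure on column vectors. *)
Definition eucl_dot (x y : 'cV[R[i]]_n) : R[i] := dotmx x^T y^T.

Definition eucl_norm (x : 'cV[R[i]]_n) : R := Num.sqrt (complex.Re (eucl_dot x x)).

(* The set below is always bounded and nonempty, so that [sup] never takes its
   default value. *)
Definition opnorm (A : 'M[R[i]]_n) : R :=
  sup [set eucl_norm (A *m x) | x in [set x | eucl_norm x <= 1]]%classic.

Definition mx_contraction (A : 'M[R[i]]_n) : Prop := opnorm A <= 1.

End EuclideanSpace.

Definition is_adjoint (R : realType) (E F : lmodType R[i])
    (dotE : E -> E -> R[i]) (dotF : F -> F -> R[i])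
    (A : E -> F) (B : F -> E) : Prop :=
  forall x y, dotF (A x) y = dotE x (B y).

(* Boundedness of U is automatic: U preserves the norm. *)
Definition unitary_operator (R : realType) (H : hilbertType R)
    (U : {linear H -> H}) : Prop :=
  exists Us : {linear H -> H},
    [/\ is_adjoint (@hdot R H) (@hdot R H) U Us, cancel U Us & cancel Us U].

Section Tuples.
Variable R : realType.

(* Only the entries q i j with i != j are meaningful. *)
Definition unimodular_family k (q : 'I_k -> 'I_k -> R[i]) : Prop :=
  forall i j : 'I_k, (i < j)%N -> `|q i j| = 1 /\ q i j = (q j i)^-1.

(* The inclusion of {qt_ij : i < j} in {q_ij : i < j} together with 1, as sets
   of scalars: the two positions need not agree. *)
Definition family_sub1 k (qt q : 'I_k -> 'I_k -> R[i]) : Prop :=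
  forall i j : 'I_k, (i < j)%N ->
    qt i j = 1 \/ exists a b : 'I_k, (a < b)%N /\ qt i j = q a b.

Definition q_commuting_mx k n (q : 'I_k -> 'I_k -> R[i])
    (T : 'I_k -> 'M[R[i]]_n) : Prop :=
  unimodular_family q /\
  forall i j : 'I_k, (i < j)%N -> T i *m T j = q i j *: (T j *m T i).

Definition q_commuting_op k (H : hilbertType R) (q : 'I_k -> 'I_k -> R[i])
    (U : 'I_k -> {linear H -> H}) : Prop :=
  unimodular_family q /\
  forall i j : 'I_k, (i < j)%N ->
    forall x, U i (U j x) = q i j *: U j (U i x).

Definition unitarily_equivalent k n (A B : 'I_k -> 'M[R[i]]_n) : Prop :=
  exists2 W : 'M[R[i]]_n, W \is unitarymx
    & forall j, W^t* *m A j *m W = B j.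

(* T_1^m_1 ... T_k^m_k, in this order *)
Definition mx_monomial k (T : 'I_k -> 'M[R[i]]_2) (m : 'I_k -> nat) :
    'M[R[i]]_2 :=
  \prod_(i < k) T i ^+ m i.

(* U_1^m_1 ... U_k^m_k, in this order *)
Definition op_monomial k (H : hilbertType R) (U : 'I_k -> {linear H -> H})
    (m : 'I_k -> nat) : H -> H :=
  \big[comp/idfun]_(i < k) iter (m i) (U i).

Definition has_q_unitary_dilation k (q : 'I_k -> 'I_k -> R[i])
    (T : 'I_k -> 'M[R[i]]_2) : Prop :=
  exists (H : hilbertType R) (U : 'I_k -> {linear H -> H})
         (V : {linear 'cV[R[i]]_2 -> H}) (Vs : {linear H -> 'cV[R[i]]_2}),
    [/\ q_commuting_op q U,
        forall i, unitary_operator (U i),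
        forall x, `|V x| = (eucl_norm x)%:C,
        is_adjoint (@eucl_dot R 2) (@hdot R H) V Vs
      & forall (m : 'I_k -> nat) (x : 'cV[R[i]]_2),
          mx_monomial T m *m x = Vs (op_monomial U m (V x))].

Definition mx2 (a b c d : R[i]) : 'M[R[i]]_2 :=
  \matrix_(i, j) if i == 0 then (if j == 0 then a else b)
                 else (if j == 0 then c else d).

Section Types.
Variables (k : nat) (q : 'I_k.+1 -> 'I_k.+1 -> R[i]).
Variable T : 'I_k.+1 -> 'M[R[i]]_2.

Definition eta_set (alpha : R[i]) : {set 'I_k.+1} :=
  [set i | T ord0 *m T i == alpha *: (T i *m T ord0)]%SET.

Definition type_I : Prop :=
  exists a r : R[i],
  [/\ a != 0, [/\ `|r| = 1, r != 1 & r != -1],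
      T ord0 = mx2 a 0 0 (r * a),
      forall j, j != ord0 -> q ord0 j = 1 \/ q ord0 j = r
    & forall j, j != ord0 ->
        (j \in eta_set 1 -> exists c f : R[i],
           [/\ `|c| = `|f|, `|f| != 0 & T j = mx2 c 0 0 f]) /\
        (j \in eta_set r -> exists e : R[i], e != 0 /\ T j = mx2 0 0 e 0)].

Definition type_II : Prop :=
  exists a r : R[i],
  [/\ a != 0, [/\ `|r| = 1, r != 1 & r != -1],
      T ord0 = mx2 a 0 0 (r * a),
      forall j, j != ord0 -> q ord0 j = 1 \/ q ord0 j = Num.conj r
    & forall j, j != ord0 ->
        (j \in eta_set 1 -> exists c f : R[i],
           [/\ `|c| = `|f|, `|f| != 0 & T j = mx2 c 0 0 f]) /\
        (j \in eta_set (Num.conj r) ->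
           exists d : R[i], d != 0 /\ T j = mx2 0 d 0 0)].

Definition type_III : Prop :=
  exists a : R[i],
  [/\ a != 0,
      T ord0 = mx2 a 0 0 (- a),
      forall j, j != ord0 -> q ord0 j = 1 \/ q ord0 j = -1
    & forall j, j != ord0 ->
        (j \in eta_set 1 -> exists c : R[i],
           c != 0 /\ (T j = mx2 c 0 0 c \/ T j = mx2 c 0 0 (- c))) /\
        (j \in eta_set (-1) -> exists d e : R[i],
           (d != 0 \/ e != 0) /\ T j = mx2 0 d e 0)].

End Types.
End Tuples.

(* Main.v *)
(* A unitary equivalence, possibly followed by the exchange of the two basis
   vectors, brings the tuple to the form T_j = t_j D_(u_j) N^(eps_j), where
   |t_j| <= 1, eps_j is 0 or 1, D_u = diag(1, u), N is the matrix with rows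
   (0, rho) and (1, 0), |rho| <= 1 and u_j^2 rho = rho (for types I and II,
   rho = 0; for type III, u_j = +-1 unless rho = 0).  If |rho| = 1, then N is
   unitary.  If |rho| < 1, then on l^2(Z; C^2), with S the bilateral shift,
   N = E_21 + rho E_12 lifts to the unitary E_21 + E_12 S, and D_u lifts to the
   multiplication by u^(2n) D_u; these lifts satisfy the same commutation
   relations.  With V x = (sqrt(1 - |rho|^2) conj(rho)^n x)_(n >= 0), V^*
   intertwines the lifts with the matrices on the sequences supported in n >= 0,
   and hence compresses all monomials correctly.  The same construction with U_j
   replaced by U_j S absorbs a scalar factor t_j, one index at a time.  The
   relation between T_i and T_j determines the scalar (namely q_ij) except when
   T_i T_j = T_j T_i = 0, in which case the lifts commute. *)
Require Import Defs.
From HB Require Import structures.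
From mathcomp Require Import all_boot all_order all_algebra complex ring.
From mathcomp Require Import all_classical all_reals all_analysis.
Set Implicit Arguments.
Unset Strict Implicit.
Unset Printing Implicit Defensive.
Import Order.TTheory GRing.Theory Num.Theory.
Import numFieldNormedType.Exports.
Local Open Scope ring_scope.

(** * Hilbert spaces from inner products *)

Section DotInequalities.
Variables (C : numClosedFieldType) (U : lmodType C).
Variable form : {dot U for Num.conj}.
Local Notation "''[' u , v ]" := (form u%R v%R) : ring_scope.
Local Notation "''[' u ]" := '[u, u]%R : ring_scope.

Lemma dotC u v : '[u, v] = ('[v, u])^*.
Proof. by rewrite hermC expr0 mul1r. Qed.

(** Pythagoras: u splits as a v + w with w orthogonal to v, and the contribution of w is dropped. *)
Lemma dot_CauchySchwarz u v : `|'[u, v]| ^+ 2 <= '[u] * '[v].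
Proof.
have [->|nz_v] := eqVneq v 0.
  by rewrite !linear0r normr0 expr0n.
pose a := '[u, v] / '[v]; pose w := u - a *: v.
have wv : '[w, v] = 0 by rewrite linearBl/= linearZl_LR divfK ?dnorm_eq0 ?subrr.
have uE : '[u] = '[w] + `|a| ^+ 2 * '[v].
  rewrite -dnormZ (_ : u = w + a *: v); last by rewrite /w subrK.
  by rewrite hnormDd //= linearZr_LR /= wv mulr0.
have aE : `|a| ^+ 2 * '[v] ^+ 2 = `|'[u, v]| ^+ 2.
  by rewrite -[X in _ * X ^+ 2]ger0_norm ?dnorm_ge0 // -exprMn -normrM divfK // dnorm_eq0.
by rewrite uE mulrDl -mulrA -expr2 aE lerDr mulr_ge0 ?dnorm_ge0.
Qed.

Lemma dot_triangle u v :
  sqrtC '[u + v] <= sqrtC '[u] + sqrtC '[v].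
Proof.
have s0 w : 0 <= sqrtC '[w] by rewrite sqrtC_ge0 dnorm_ge0.
rewrite -ler_sqr ?nnegrE ?addr_ge0 // sqrrD !sqrtCK dnormD /= [leRHS]addrAC lerD2l.
have -> : '[u, v] + ('[u, v])^* = 'Re '[u, v] *+ 2.
  by rewrite ReE -mulr_natr divfK // pnatr_eq0.
rewrite lerMn2r /= (le_trans (leif_Re_Creal _)) //.
rewrite -sqrtCM ?nnegrE ?dnorm_ge0 // -[leLHS]sqrCK //.
by rewrite ler_sqrtC ?nnegrE ?exprn_ge0 ?mulr_ge0 ?dnorm_ge0 ?dot_CauchySchwarz.
Qed.

Lemma dot_parallelogram u v : '[u + v] + '[u - v] = '[u] *+ 2 + '[v] *+ 2.
Proof.
rewrite dnormD dnormB /=; move: (_ + _ ^*) => d.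
by rewrite addrACA subrr addr0 -mulr2n mulrnDl.
Qed.

(** The parallelogram law with one term dropped. It replaces the triangle inequality in estimates
    that stay with squared norms. *)
Lemma dot_leD u v : '[u + v] <= '[u] *+ 2 + '[v] *+ 2.
Proof. by rewrite -dot_parallelogram lerDl dnorm_ge0. Qed.

End DotInequalities.

Local Open Scope complex_scope.

Section HilbertOfDot.
Variables (R : realType) (E : lmodType R[i]) (d : {dot E for Num.conj}).

(** Completeness in terms of the form alone, with squared distances and Cauchy filters, so that it
    makes sense before E is given any norm or topology. *)
Definition dot_complete := forall F : set_system E, ProperFilter F ->
  (forall e : R[i], 0 < e -> exists x, F [set y | d (x - y) (x - y) < e]%classic) ->
  exists l, forall e : R[i], 0 < e -> F [set y | d (l - y) (l - y) < e]%classic.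

(** The norm of the form goes on an alias, since E may carry another norm already, as column vectors
    do with the max norm. *)
Definition hspace : Type := E.

HB.instance Definition _ := GRing.Lmodule.on hspace.

Definition hspace_norm (x : hspace) : R[i] := sqrtC (d x x).

Lemma hspace_normD (x y : hspace) :
  hspace_norm (x + y) <= hspace_norm x + hspace_norm y.
Proof. exact: dot_triangle. Qed.

Lemma hspace_normZ (a : R[i]) (x : hspace) :
  hspace_norm (a *: x) = `|a| * hspace_norm x.
Proof.
rewrite /hspace_norm dnormZ sqrtCM ?nnegrE ?exprn_ge0 ?dnorm_ge0 //.
by rewrite sqrCK.
Qed.

Lemma hspace_norm0_eq0 (x : hspace) : hspace_norm x = 0 -> x = 0.
Proof. by move/eqP; rewrite /hspace_norm sqrtC_eq0 dnorm_eq0 => /eqP. Qed.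

HB.instance Definition _ := Lmodule_isNormed.Build R[i] hspace
  hspace_normD hspace_normZ hspace_norm0_eq0.

Lemma hspace_normE (x : hspace) : `|x| = sqrtC (d x x).
Proof. by []. Qed.

Lemma hspace_dot_norm (x : hspace) : d x x = `|x| ^+ 2.
Proof. by rewrite hspace_normE sqrtCK. Qed.

Lemma hspace_complete (dc : dot_complete) (F : set_system hspace) :
  ProperFilter F -> cauchy F -> cvg F.
Proof.
move=> FF /cauchyP Fc.
have ltd (x : hspace) (e : R[i]) : 0 < e -> `|x| < e -> d x x < e ^+ 2.
  by move=> e0 xe; rewrite hspace_dot_norm ltr_sqr ?nnegrE ?(ltW e0).
have [l lF] : exists l : E, forall e : R[i], 0 < e ->
    F [set y | d (l - y) (l - y) < e]%classic.
  apply: dc => e e0; have s0 : 0 < sqrtC e by rewrite sqrtC_gt0.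
  have [x Fx] := Fc _ s0; exists x.
  apply: filterS Fx => y; rewrite -ball_normE /= => /ltd.
  by rewrite sqrtCK; apply.
apply/cvg_ex; exists l; apply/cvgrPdist_lt => e e0.
near=> y.
have /= : d (l - y) (l - y) < e ^+ 2.
  by near: y; apply: lF; rewrite exprn_gt0.
by rewrite hspace_dot_norm ltr_sqr ?nnegrE ?(ltW e0).
Unshelve. all: by end_near. Qed.

(* [hspace] and [E] are distinct packed structures although their carriers and
   operations agree, so that the form [d] has to be packed again. *)
Definition hspace_dot (x y : hspace) : R[i] := d x y.

Lemma hspace_dot_bilinear : bilinear_for
  (GRing.Scale.Law.clone _ _ ( *%R ) _) (GRing.Scale.Law.clone _ _ (Num.conj \; *%R) _)
  hspace_dot.
Proof.
split=> [y a u v|x a u v]; first exact: linearPl.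
exact: linearPr.
Qed.

HB.instance Definition _ := bilinear_isBilinear.Build R[i] hspace hspace R[i]
  _ _ hspace_dot hspace_dot_bilinear.

HB.instance Definition _ := isHermitianSesquilinear.Build R[i] hspace false
  Num.conj hspace_dot (@hermC _ _ _ _ d).

HB.instance Definition _ := isDotProduct.Build R[i] hspace hspace_dot
  (@neq0_dnorm_gt0 _ _ _ d).

Definition hspace_completeType (dc : dot_complete) : completeNormedModType R[i] :=
  HB.pack hspace (Uniform_isComplete.Build hspace (hspace_complete dc)).

Definition hilbert_of_dot (dc : dot_complete) : hilbertType R :=
  @Hilbert R (hspace_completeType dc) hspace_dot hspace_dot_norm.

End HilbertOfDot.

(** * Series of complex numbers *)

Section ComplexSeries.
Variable R : realType.
Implicit Types (u v : nat -> R[i]) (a z : R[i]).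
Local Notation Re := complex.Re.
Local Notation Im := complex.Im.

(** Convergence of the partial sums is meant, not absolute convergence. Splitting into real and
    imaginary parts gives access to the theory of real series. *)
Definition csummable u :=
  cvgn (series (fun n => Re (u n))) /\ cvgn (series (fun n => Im (u n))).

(* [limn] is a junk value unless [csummable u] holds. *)
Definition csum u : R[i] :=
  limn (series (fun n => Re (u n))) +i* limn (series (fun n => Im (u n))).

Lemma ReD (x y : R[i]) : Re (x + y) = Re x + Re y. Proof. exact: raddfD. Qed.
Lemma ImD (x y : R[i]) : Im (x + y) = Im x + Im y. Proof. exact: raddfD. Qed.
Lemma ReM (x y : R[i]) : Re (x * y) = Re x * Re y - Im x * Im y.
Proof. by case: x y => [a b] [c e]. Qed.
Lemma ImM (x y : R[i]) : Im (x * y) = Re x * Im y + Im x * Re y.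
Proof. by case: x y => [a b] [c e]. Qed.

Lemma csummable0 : csummable (fun=> 0) /\ csum (fun=> 0) = 0.
Proof.
have E0 : series (fun=> 0 : R) = fun=> 0.
  by apply/funext => n; rewrite /series /= big1.
split; first by split; rewrite E0; exact: is_cvg_cst.
by rewrite /csum /= E0 lim_cst.
Qed.

Lemma csummableD u v : csummable u -> csummable v ->
  csummable (fun n => u n + v n) /\ csum (fun n => u n + v n) = csum u + csum v.
Proof.
move=> [ur ui] [vr vi].
have Er : (fun n => Re (u n + v n)) = (fun n => Re (u n)) + (fun n => Re (v n)).
  by apply/funext => n; rewrite ReD.
have Ei : (fun n => Im (u n + v n)) = (fun n => Im (u n)) + (fun n => Im (v n)).
  by apply/funext => n; rewrite ImD.
rewrite /csummable /csum Er Ei; split; first by split; apply: is_cvg_seriesD.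
by rewrite !lim_seriesD.
Qed.

Lemma csummableZ a u : csummable u ->
  csummable (fun n => a * u n) /\ csum (fun n => a * u n) = a * csum u.
Proof.
move=> [ur ui].
have Er : (fun n => Re (a * u n)) =
    Re a *: (fun n => Re (u n)) + (- Im a) *: (fun n => Im (u n)).
  by apply/funext => n; rewrite ReM /= scaleNr.
have Ei : (fun n => Im (a * u n)) =
    Re a *: (fun n => Im (u n)) + Im a *: (fun n => Re (u n)).
  by apply/funext => n; rewrite ImM.
have cZ (k : R) (f : nat -> R) : cvgn (series f) -> cvgn (series (k *: f)).
  exact: is_cvg_seriesZ.
have lZ (k : R) (f : nat -> R) : cvgn (series f) ->
    limn (series (k *: f)) = k *: limn (series f).
  exact: lim_seriesZ.
rewrite /csummable /csum Er Ei; split.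
  by split; apply: is_cvg_seriesD; apply: cZ.
rewrite !lim_seriesD; try exact: cZ.
rewrite !lZ //.
by case: a {Er Ei cZ lZ} => ar ai /=; rewrite scaleNr.
Qed.

Lemma csummable_conj u : csummable u ->
  csummable (fun n => Num.conj (u n)) /\
  csum (fun n => Num.conj (u n)) = Num.conj (csum u).
Proof.
move=> [ur ui].
have Er : (fun n => Re (Num.conj (u n))) = (fun n => Re (u n)).
  by apply/funext => n; case: (u n).
have Ei : (fun n => Im (Num.conj (u n))) = - (fun n => Im (u n)).
  by apply/funext => n; transitivity (- Im (u n)) => //; case: (u n).
rewrite /csummable /csum Er Ei; split; last by rewrite lim_seriesN.
by split=> //; rewrite is_cvg_seriesN.
Qed.

Lemma series_recl (f : nat -> R) (l : R) :
  (series f @ \oo --> f 0%N + l)%classic <->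
  (series (fun n => f n.+1) @ \oo --> l)%classic.
Proof.
have E n : series f n.+1 = f 0%N + series (fun k => f k.+1) n.
  by rewrite /series /= big_nat_recl.
split=> [|h].
  rewrite -(cvg_shiftS (series f)) => h.
  have -> : series (fun n => f n.+1) = (fun n => series f n.+1 - f 0%N).
    by apply/funext => n; rewrite E addrC addKr.
  by rewrite -[l](addKr (f 0%N)) addrC; apply: cvgB => //; exact: cvg_cst.
rewrite -(cvg_shiftS (series f)).
have -> : [sequence series f n.+1]_n = (fun n => f 0%N + series (fun k => f k.+1) n).
  by apply/funext => n; rewrite /mk_sequence E.
by apply: cvgD => //; exact: cvg_cst.
Qed.

Lemma cvg_series_recl (f : nat -> R) : cvgn (series (fun n => f n.+1)) ->
  cvgn (series f) /\ limn (series f) = f 0%N + limn (series (fun n => f n.+1)).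
Proof.
move/cvg_ex => [l fl]; rewrite (cvg_lim _ fl) //.
move/series_recl: fl => fl; split; first by apply/cvg_ex; eexists; exact: fl.
exact: cvg_lim.
Qed.

Lemma csummableS u : csummable u -> csummable (fun n => u n.+1).
Proof.
move=> [/cvg_ex[/= a ua] /cvg_ex[/= b ub]]; split; apply/cvg_ex.
- by exists (a - Re (u 0%N)); apply/(series_recl (fun n => Re (u n))); rewrite addrC subrK.
- by exists (b - Im (u 0%N)); apply/(series_recl (fun n => Im (u n))); rewrite addrC subrK.
Qed.

Lemma csummable_recl u : csummable (fun n => u n.+1) ->
  csummable u /\ csum u = u 0%N + csum (fun n => u n.+1).
Proof.
move=> [sr si].
have [ur lr] := @cvg_series_recl (fun n => Re (u n)) sr.
have [ui li] := @cvg_series_recl (fun n => Im (u n)) si; split=> //.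
by rewrite /csum lr li; case: (u 0%N).
Qed.

Lemma csum_ge_partial u n : (forall n, 0 <= u n) -> csummable u ->
  \sum_(0 <= k < n) u k <= csum u.
Proof.
move=> u0 [ur ui].
have Eu m : u m = (Re (u m))%:C by rewrite RRe_real // ger0_real.
have -> : csum u = (limn (series (fun n => Re (u n))))%:C.
  rewrite /csum; congr (_ +i* _).
  have -> : (fun n => Im (u n)) = (fun=> 0) by apply/funext => m; rewrite Eu.
  have -> : series (fun=> 0 : R) = (fun=> 0) by apply/funext => m; rewrite /series /= big1.
  exact: lim_cst.
have -> : \sum_(0 <= k < n) u k = (series (fun n => Re (u n)) n)%:C.
  by rewrite /series /= rmorph_sum /=; apply: eq_bigr => k _.
rewrite lecR; apply: nondecreasing_cvgn_le => //.
apply: nondecreasing_series => k _ _; have := u0 k.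
by rewrite Eu ler0c.
Qed.

Lemma csum_ge0 u : (forall n, 0 <= u n) -> csummable u -> 0 <= csum u.
Proof. by move=> u0 /(csum_ge_partial 0 u0); rewrite big_nil. Qed.

Lemma csum_ge_term u n : (forall n, 0 <= u n) -> csummable u -> u n <= csum u.
Proof.
move=> u0 us; apply: le_trans (csum_ge_partial n.+1 u0 us).
by rewrite big_nat_recr //= lerDr sumr_ge0.
Qed.

(** Nonnegative complex numbers are real, so this is monotone convergence for the real parts; the
    imaginary series vanishes. *)
Lemma csummable_bounded u (M : R[i]) : (forall n, 0 <= u n) ->
  (forall n, \sum_(0 <= k < n) u k <= M) -> csummable u /\ csum u <= M.
Proof.
move=> u0 uM.
have Eu m : u m = (Re (u m))%:C by rewrite RRe_real // ger0_real.
have E0 : series (fun n => Im (u n)) = (fun=> 0).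
  by apply/funext => m; rewrite /series /= big1 // => k _; rewrite Eu.
have EM : M = (Re M)%:C.
  by rewrite RRe_real // ger0_real // (le_trans _ (uM 0%N)) // big_nil.
have sM n : series (fun n => Re (u n)) n <= Re M.
  rewrite -lecR -EM; apply: le_trans (uM n); rewrite /series /= rmorph_sum /=.
  by rewrite le_eqVlt; apply/orP; left; apply/eqP; apply: eq_bigr => k _.
have cr : cvgn (series (fun n => Re (u n))).
  apply: nondecreasing_is_cvgn; last by exists (Re M) => _ [n _ <-].
  by apply: nondecreasing_series => k _ _; have := u0 k; rewrite Eu ler0c.
split.
  by split=> //; rewrite E0; apply: is_cvg_cst.
rewrite /csum E0 lim_cst // EM lecR; apply: limr_le => //.
by apply: nearW.
Qed.

Lemma csummable_le u v : (forall n, `|u n| <= v n) -> csummable v -> csummable u.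
Proof.
move=> uv [vr _].
have Ev n : v n = (Re (v n))%:C.
  by rewrite RRe_real // ger0_real // (le_trans _ (uv n)).
have H (f : nat -> R) : (forall n, `|f n| <= Re (v n)) -> cvgn (series f).
  move=> fv; apply: normed_cvg; apply: series_le_cvg vr => n //=.
  by rewrite (le_trans _ (fv n)).
split; apply: H => n; rewrite -lecR -Ev; apply: le_trans (uv n).
  exact: normc_ge_Re.
rewrite (_ : Im _ = - Re (u n * 'i)); last by rewrite ReiNIm opprK.
rewrite normrN (le_trans (normc_ge_Re _)) // normrM.
by rewrite (_ : `|'i| = 1) ?mulr1 // complexiE normCi.
Qed.

(** The normalization by 1 - t is the one that later makes the embedding [hardy] isometric. *)
Lemma csum_geometric (t : R) : `|t| < 1 ->
  csummable (fun n => ((1 - t) * t ^+ n)%:C) /\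
  csum (fun n => ((1 - t) * t ^+ n)%:C) = 1.
Proof.
move=> t1; have h := @cvg_geometric_series _ (1 - t) _ t1.
have n1 : 1 - t != 0.
  by rewrite subr_eq0; apply: contraTneq t1 => <-; rewrite normr1 ltxx.
have [[_ c0] e0] := csummable0; rewrite mulfV // in h.
split; first by split=> //; apply/cvg_ex; exists 1; exact: h.
have e0i := congr1 (fun z : R[i] => Im z) e0; rewrite /csum (cvg_lim _ h) //.
by congr (_ +i* _).
Qed.

End ComplexSeries.

(** * Series indexed by the integers *)

Section IntSeries.
Variable R : realType.
Implicit Types (u v : int -> R[i]) (a : R[i]).

(** [Negz n] is -(n + 1), so the two halves partition the integers and 0 belongs to the first. *)
Definition zsummable u := csummable (fun n => u n%:Z) /\ csummable (fun n => u (Negz n)).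

Definition zsum u : R[i] := csum (fun n => u n%:Z) + csum (fun n => u (Negz n)).

Lemma zsummableD u v : zsummable u -> zsummable v ->
  zsummable (fun n => u n + v n) /\ zsum (fun n => u n + v n) = zsum u + zsum v.
Proof.
move=> [up un] [vp vn].
have [sp ep] := csummableD up vp; have [sn en] := csummableD un vn.
by split=> //; rewrite /zsum ep en addrACA.
Qed.

Lemma zsummableZ a u : zsummable u ->
  zsummable (fun n => a * u n) /\ zsum (fun n => a * u n) = a * zsum u.
Proof.
move=> [up un]; have [sp ep] := csummableZ a up; have [sn en] := csummableZ a un.
by split=> //; rewrite /zsum ep en mulrDr.
Qed.

Lemma zsummable_conj u : zsummable u ->
  zsummable (fun n => Num.conj (u n)) /\
  zsum (fun n => Num.conj (u n)) = Num.conj (zsum u).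
Proof.
move=> [up un]; have [sp ep] := csummable_conj up.
by have [sn en] := csummable_conj un; split=> //; rewrite /zsum ep en rmorphD.
Qed.

(** The shift moves a single term, u (-1), from the negative half to the nonnegative half. *)
Lemma zsummable_shift u : zsummable u ->
  zsummable (fun n => u (n - 1)) /\ zsum (fun n => u (n - 1)) = zsum u.
Proof.
move=> [up un].
have Ep : (fun n : nat => u (n.+1%:Z - 1)) = (fun n => u n%:Z).
  by apply/funext => n; rewrite -addn1 PoszD addrK.
have En : (fun n : nat => u (Negz n - 1)) = (fun n => u (Negz n.+1)).
  apply/funext => n; congr (u _); rewrite !NegzE -opprD.
  by rewrite -[in RHS]addn1 PoszD.
have [sp ep] : csummable (fun n : nat => u (n%:Z - 1)) /\
    csum (fun n : nat => u (n%:Z - 1)) = u (-1) + csum (fun n => u n%:Z).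
  by have := @csummable_recl R (fun n : nat => u (n%:Z - 1)); rewrite Ep sub0r; apply.
have [_ en] := csummable_recl (csummableS un).
rewrite /zsummable /zsum En; split; first by split=> //; exact: (csummableS un).
by rewrite ep en -addrA addrCA.
Qed.

Lemma zsummable_shiftV u : zsummable u ->
  zsummable (fun n => u (n + 1)) /\ zsum (fun n => u (n + 1)) = zsum u.
Proof.
move=> [up un].
have Ep : (fun n : nat => u (n%:Z + 1)) = (fun n => u n.+1%:Z).
  by apply/funext => n; rewrite -[in RHS]addn1 PoszD.
have En : (fun n : nat => u (Negz n.+1 + 1)) = (fun n => u (Negz n)).
  apply/funext => n; congr (u _); rewrite !NegzE -[in LHS]addn1 PoszD opprD.
  by rewrite subrK.
have [sn en] : csummable (fun n : nat => u (Negz n + 1)) /\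
    csum (fun n : nat => u (Negz n + 1)) = u 0 + csum (fun n => u (Negz n)).
  by have := @csummable_recl R (fun n : nat => u (Negz n + 1)); rewrite En; apply.
have [_ ep] := csummable_recl (csummableS up).
rewrite /zsummable /zsum Ep; split; first by split=> //; exact: (csummableS up).
by rewrite en ep addrCA addrA.
Qed.

Lemma zsummable0 : zsummable (fun=> 0 : R[i]).
Proof. by have [c0 _] := csummable0 R. Qed.

Lemma zsum_pos u : (forall n, u (Negz n) = 0) -> zsum u = csum (fun n => u n%:Z).
Proof.
move=> un; rewrite /zsum (_ : (fun n => u (Negz n)) = fun=> 0); last exact/funext.
by rewrite (proj2 (csummable0 R)) addr0.
Qed.

Lemma zsummable_pos u : (forall n, u (Negz n) = 0) ->
  csummable (fun n => u n%:Z) -> zsummable u.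
Proof.
move=> un up; split=> //; rewrite (_ : (fun n => u (Negz n)) = fun=> 0).
  exact: (proj1 (csummable0 R)).
exact/funext.
Qed.

Lemma zsum_ge0 u : (forall n, 0 <= u n) -> zsummable u -> 0 <= zsum u.
Proof. by move=> u0 [up un]; rewrite addr_ge0 // csum_ge0. Qed.

Lemma zsum_ge_term u n : (forall n, 0 <= u n) -> zsummable u -> u n <= zsum u.
Proof.
move=> u0 [up un]; case: n => n.
  by rewrite ler_wpDr ?csum_ge0 //; exact: (@csum_ge_term _ (fun n => u n%:Z)).
by rewrite ler_wpDl ?csum_ge0 //; exact: (@csum_ge_term _ (fun n => u (Negz n))).
Qed.

Lemma zsummable_le u v : (forall n, `|u n| <= v n) -> zsummable v -> zsummable u.
Proof. by move=> uv [vp vn]; split; [apply: csummable_le vp|apply: csummable_le vn]. Qed.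

(** The factor 2 comes from bounding each half by M separately. *)
Lemma zsummable_bounded u (M : R[i]) : (forall n, 0 <= u n) ->
  (forall n, \sum_(0 <= k < n) u k%:Z + \sum_(0 <= k < n) u (Negz k) <= M) ->
  zsummable u /\ zsum u <= M *+ 2.
Proof.
move=> u0 uM.
have [sp ep] : csummable (fun n => u n%:Z) /\ csum (fun n => u n%:Z) <= M.
  apply: csummable_bounded => // n; apply: le_trans (uM n).
  by rewrite lerDl sumr_ge0.
have [sn en] : csummable (fun n => u (Negz n)) /\ csum (fun n => u (Negz n)) <= M.
  apply: csummable_bounded => // n; apply: le_trans (uM n).
  by rewrite lerDr sumr_ge0.
by split=> //; rewrite mulr2n lerD.
Qed.

Lemma zsum_ge_partial u n : (forall n, 0 <= u n) -> zsummable u ->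
  \sum_(0 <= k < n) u k%:Z + \sum_(0 <= k < n) u (Negz k) <= zsum u.
Proof.
move=> u0 [up un]; apply: lerD.
  exact: (@csum_ge_partial _ (fun n => u n%:Z)).
exact: (@csum_ge_partial _ (fun n => u (Negz n))).
Qed.

End IntSeries.

(** * Square-summable bilateral sequences *)

Section SquareSummable.
Variables (R : realType) (E : lmodType R[i]) (d : {dot E for Num.conj}).
Implicit Types f g : int -> E.

Definition sqsum : {pred int -> E} :=
  [pred f | `[< zsummable (fun n => d (f n) (f n)) >]].

Lemma sqsumP f : reflect (zsummable (fun n => d (f n) (f n))) (f \in sqsum).
Proof. by rewrite inE; exact: asboolP. Qed.

Lemma zsummable_eq (u v : int -> R[i]) : u =1 v -> zsummable u -> zsummable v.
Proof. by move/funext => ->. Qed.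

Lemma zsum_eq (u v : int -> R[i]) : u =1 v -> zsum u = zsum v.
Proof. by move/funext => ->. Qed.

Lemma sqsum_le f (v : int -> R[i]) :
  (forall n, d (f n) (f n) <= v n) -> zsummable v -> f \in sqsum.
Proof.
move=> fv vs; apply/sqsumP; apply: zsummable_le vs => n.
by rewrite ger0_norm ?dnorm_ge0.
Qed.

Lemma sqsum_submod : submod_closed sqsum.
Proof.
split=> [|a f g /sqsumP fs /sqsumP gs].
  apply/sqsumP; apply: zsummable_eq (zsummable0 R) => n.
  exact: esym (linear0l _ _).
apply: (@sqsum_le _ (fun n => (`|a| ^+ 2 *+ 2) * d (f n) (f n) + 2%:R * d (g n) (g n))).
  move=> n; apply: le_trans (dot_leD _ _ _) _.
  by rewrite dnormZ mulrnAl mulr_natl.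
by apply: (proj1 (zsummableD _ _)); apply: (proj1 (zsummableZ _ _)).
Qed.

HB.instance Definition _ := GRing.isSubmodClosed.Build R[i] (int -> E) sqsum sqsum_submod.

Record ell2 := Ell2 { ell2_val :> int -> E; ell2_valP : ell2_val \in sqsum }.
HB.instance Definition _ := [isSub for ell2_val].
HB.instance Definition _ := [Choice of ell2 by <:].
HB.instance Definition _ := [SubChoice_isSubLmodule of ell2 by <:].

Lemma ell2P (f g : ell2) : (forall n, f n = g n) -> f = g.
Proof. by move=> fg; apply: val_inj; apply/funext. Qed.

Lemma ell2D (f g : ell2) n : (f + g) n = f n + g n. Proof. by []. Qed.
Lemma ell2B (f g : ell2) n : (f - g) n = f n - g n. Proof. by []. Qed.
Lemma ell2Z a (f : ell2) n : (a *: f) n = a *: f n. Proof. by []. Qed.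

(** With a = d (f n) (f n) and b = d (g n) (g n), Cauchy-Schwarz gives a squared modulus of at most
    a b, which is at most (a + b)^2; and a + b is summable. *)
Lemma ell2_summable (f g : ell2) : zsummable (fun n => d (f n) (g n)).
Proof.
apply: (@zsummable_le _ _ (fun n => d (f n) (f n) + d (g n) (g n))).
  move=> n; rewrite -ler_sqr ?nnegrE ?addr_ge0 ?dnorm_ge0 //.
  apply: le_trans (dot_CauchySchwarz _ _ _) _.
  rewrite sqrrD -addrA addrCA mulr2n -addrA lerDl.
  by rewrite !addr_ge0 ?exprn_ge0 ?mulr_ge0 ?dnorm_ge0.
by apply: (proj1 (zsummableD _ _)); apply/sqsumP; exact: ell2_valP.
Qed.

Definition ell2_dot (f g : ell2) : R[i] := zsum (fun n => d (f n) (g n)).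

Lemma ell2_dot_bilinear : bilinear_for
  (GRing.Scale.Law.clone _ _ ( *%R ) _) (GRing.Scale.Law.clone _ _ (Num.conj \; *%R) _)
  ell2_dot.
Proof.
split=> [g a f f'|f a g g'] /=.
  rewrite /ell2_dot -(proj2 (zsummableZ _ (ell2_summable _ _))).
  rewrite -(proj2 (zsummableD (proj1 (zsummableZ _ (ell2_summable _ _)))
    (ell2_summable _ _))).
  by apply: zsum_eq => n; rewrite ell2D ell2Z linearPl.
rewrite /ell2_dot -(proj2 (zsummableZ _ (ell2_summable _ _))).
rewrite -(proj2 (zsummableD (proj1 (zsummableZ _ (ell2_summable _ _)))
  (ell2_summable _ _))).
by apply: zsum_eq => n; rewrite ell2D ell2Z linearPr.
Qed.

HB.instance Definition _ := bilinear_isBilinear.Build R[i] ell2 ell2 R[i]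
  _ _ ell2_dot ell2_dot_bilinear.

Lemma ell2_dot_herm (f g : ell2) :
  ell2_dot f g = (-1) ^+ false * Num.conj (ell2_dot g f).
Proof.
rewrite expr0 mul1r /ell2_dot -(proj2 (zsummable_conj (ell2_summable _ _))).
by apply: zsum_eq => n; rewrite dotC.
Qed.

HB.instance Definition _ := isHermitianSesquilinear.Build R[i] ell2 false
  Num.conj ell2_dot ell2_dot_herm.

Lemma ell2_dot_gt0 (f : ell2) : f != 0 -> 0 < ell2_dot f f.
Proof.
move=> f0; have d0 n : 0 <= d (f n) (f n) by exact: dnorm_ge0.
rewrite lt_def zsum_ge0 ?andbT //; last exact: ell2_summable.
apply: contra f0 => /eqP e; apply/eqP/ell2P => n; apply/eqP.
by rewrite -(dnorm_eq0 d) eq_le d0 -e zsum_ge_term //; exact: ell2_summable.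
Qed.

HB.instance Definition _ := isDotProduct.Build R[i] ell2 ell2_dot ell2_dot_gt0.

End SquareSummable.

Section Ell2Complete.
Variables (R : realType) (E : lmodType R[i]) (d : {dot E for Num.conj}).
Hypothesis dc : dot_complete d.
Local Notation ell2 := (ell2 d).

(** Coordinatewise limits l n exist because each coordinate is dominated by the whole norm. Bounds
    on the truncations [P N], uniform in N, then show that l differs from members of the filter by
    small square-summable sequences. *)
Lemma ell2_complete : dot_complete (@ell2_dot R E d : {dot ell2 for Num.conj}).
Proof.
move=> F FF Fc.
have d_ge0 (x : E) : 0 <= d x x by exact: dnorm_ge0.
have dsym (x y : E) : d (x - y) (x - y) = d (y - x) (y - x).
  by rewrite -opprB hnormN.
have coord n : exists l : E, forall e : R[i], 0 < e ->
    F [set f : ell2 | d (l - f n) (l - f n) < e]%classic.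
  have [e e0|l lF] := dc (F := ((fun f : ell2 => f n) @ F)%classic) _; last by exists l.
  have [x Fx] := Fc e e0; exists (x n); rewrite /fmap /=.
  apply: filterS Fx => f /=; apply: le_lt_trans.
  apply: (@zsum_ge_term _ (fun n => d ((x - f) n) ((x - f) n))) => //.
  exact: ell2_summable.
have [l lF] := choice coord.
pose P N (f g : int -> E) :=
  \sum_(0 <= k < N) d (f k%:Z - g k%:Z) (f k%:Z - g k%:Z) +
  \sum_(0 <= k < N) d (f (Negz k) - g (Negz k)) (f (Negz k) - g (Negz k)).
have PF N e : 0 < e -> F [set f : ell2 | P N l f < e]%classic.
  elim: N e => [|N IH] e e0.
    by apply: filterS filterT => f _ /=; rewrite /P !big_nil addr0.
  have e3 : 0 < e / 3%:R by rewrite divr_gt0 // ltr0n.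
  near=> f; rewrite /= /P !big_nat_recr //= addrACA.
  have -> : e = e / 3%:R + (e / 3%:R + e / 3%:R).
    by rewrite -!mulrDl -mulr2n -mulrS -[_ *+ 3]mulr_natr mulfK // pnatr_eq0.
  apply: ltrD; first by near: f; exact: IH.
  by apply: ltrD; near: f; exact: lF.
(* Here h stands for l - f as an element of the space; l itself is not yet known to be
   square-summable. *)
have key e : 0 < e -> exists A : set ell2, F A /\ forall f, A f ->
    exists h : ell2, (forall n, h n = l n - f n) /\ ell2_dot h h < e.
  (* The truncations will be bounded by 10 e1, hence the norm by 20 e1 < 21 e1 = e. *)
  move=> e0; pose e1 := e / 21%:R.
  have e10 : 0 < e1 by rewrite divr_gt0 // ltr0n.
  have [x Fx] := Fc e1 e10.
  exists [set y | ell2_dot (x - y) (x - y) < e1]%classic; split=> // f /= xf.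
  (* An auxiliary g, depending on N, is close to l on the window and close to x globally. By
     [dot_leD], going from g to f through x costs 2 + 2 = 4, and from l to f through g costs 2 + 2 *
     4 = 10. *)
  have bnd N : P N l f <= e1 *+ 10.
    have [g [/= gl gx]] : exists g : ell2, P N l g < e1 /\ ell2_dot (x - g) (x - g) < e1.
      by apply: (@filter_ex _ F); apply: filterI => //; exact: PF.
    have gf : ell2_dot (g - f) (g - f) <= e1 *+ 4.
      have gxE : ell2_dot (g - x) (g - x) = ell2_dot (x - g) (x - g).
        by rewrite -[X in ell2_dot X _]opprB -[X in ell2_dot _ X]opprB; exact: hnormN.
      have := dot_leD (@ell2_dot R E d : {dot ell2 for Num.conj}) (g - x) (x - f).
      rewrite addrA subrK /= gxE => /le_trans; apply.
      rewrite (_ : 4 = 2 + 2)%N // mulrnDr.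
      by rewrite lerD // lerMn2r /= ltW.
    have Pgf : P N g f <= e1 *+ 4.
      apply: le_trans gf.
      apply: (@zsum_ge_partial _ (fun n => d ((g - f) n) ((g - f) n))) => //.
      exact: ell2_summable.
    have PD : P N l f <= P N l g *+ 2 + P N g f *+ 2.
      rewrite /P !mulrnDl -!sumrMnl addrACA -!big_split /=.
      apply: ler_sum => k _.
      by apply: lerD; rewrite (le_trans _ (dot_leD _ _ _)) // addrA subrK.
    apply: le_trans PD _; rewrite (_ : 10 = 2 + 4 * 2)%N // mulrnDr mulrnA.
    by apply: lerD; rewrite lerMn2r /= // ltW.
  have [hs hb] := @zsummable_bounded _ (fun n => d (l n - f n) (l n - f n)) _
    (fun n => d_ge0 _) bnd.
  have hP : (fun n => l n - f n) \in sqsum d by apply/sqsumP.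
  exists (Ell2 hP); split=> //; apply: le_lt_trans hb _.
  rewrite -mulrnA -[ltRHS](@divfK _ 21%:R) ?pnatr_eq0 // mulr_natr -/e1.
  by rewrite ltr_pMn2l.
have [A [FA /= hA]] := key 1 ltr01.
have [f /hA[h [hE _]]] := filter_ex FA.
(* The entries of h + f are the l n, so l is square-summable after all. *)
exists (h + f) => e e0; have [B [FB hB]] := key e e0.
apply: filterS FB => g /hB[h' [h'E]] /=.
suff -> : h' = h + f - g by [].
by apply: ell2P => n; rewrite h'E ell2B ell2D hE subrK.
Unshelve. all: by end_near. Qed.

End Ell2Complete.

(** * Laurent operators *)

Section Unimodular.
Variable R : realType.

Lemma unimodular_conj (w : R[i]) : `|w| = 1 -> Num.conj w = w^-1.
Proof. by move=> w1; rewrite invC_norm w1 expr1n invr1 mul1r. Qed.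

Lemma unimodular_neq0 (w : R[i]) : `|w| = 1 -> w != 0.
Proof. by move=> w1; rewrite -normr_eq0 w1 oner_eq0. Qed.

End Unimodular.

Section SqsumClosure.
Variables (R : realType) (E : lmodType R[i]) (d : {dot E for Num.conj}).
Implicit Types f g : int -> E.

Lemma sqsum_dom f g : g \in sqsum d ->
  (forall n, d (f n) (f n) <= d (g n) (g n)) -> f \in sqsum d.
Proof. by move=> /sqsumP gs fg; exact: sqsum_le fg gs. Qed.

Lemma sqsum_shift f : f \in sqsum d -> (fun n => f (n - 1)) \in sqsum d.
Proof.
by move=> /sqsumP fs; apply/sqsumP; exact: (proj1 (zsummable_shift fs)).
Qed.

Lemma sqsum_shiftV f : f \in sqsum d -> (fun n => f (n + 1)) \in sqsum d.
Proof.
by move=> /sqsumP fs; apply/sqsumP; exact: (proj1 (zsummable_shiftV fs)).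
Qed.

End SqsumClosure.

Section Laurent.
Variables (R : realType) (E : lmodType R[i]) (d : {dot E for Num.conj}).

(* The data of the operator (f_n) |-> (w^n (A f_n + B f_(n-1))) on the space of
   square-summable sequences; the identities between A, B and their adjoints say
   that A + z B is unitary for all z of modulus one. *)
Record symbol := Symbol {
  symA : {linear E -> E}; symB : {linear E -> E};
  symA' : {linear E -> E}; symB' : {linear E -> E};
  symw : R[i];
  sym_adjA : is_adjoint d d symA symA';
  sym_adjB : is_adjoint d d symB symB';
  sym_AA' : forall x, symA (symA' x) + symB (symB' x) = x;
  sym_A'A : forall x, symA' (symA x) + symB' (symB x) = x;
  sym_AB' : forall x, symA (symB' x) = 0;
  sym_BA' : forall x, symB (symA' x) = 0;
  sym_A'B : forall x, symA' (symB x) = 0;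
  sym_B'A : forall x, symB' (symA x) = 0;
  sym_norm : `|symw| = 1 }.

Variable s : symbol.
Local Notation A := (symA s).
Local Notation B := (symB s).
Local Notation A' := (symA' s).
Local Notation B' := (symB' s).
Local Notation w := (symw s).

Lemma is_adjointC (X X' : E -> E) : is_adjoint d d X X' -> is_adjoint d d X' X.
Proof. by move=> XX' x y; rewrite dotC -XX' -dotC. Qed.

Lemma sym_normD x : d (A x) (A x) + d (B x) (B x) = d x x.
Proof. by rewrite sym_adjA sym_adjB -linearDr sym_A'A. Qed.

Lemma sym_normD' x : d (A' x) (A' x) + d (B' x) (B' x) = d x x.
Proof.
by rewrite (is_adjointC (@sym_adjA s)) (is_adjointC (@sym_adjB s)) -linearDr sym_AA'.
Qed.

Lemma sym_wn n : `|w ^ n| = 1.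
Proof.
case: n => n; rewrite ?NegzE -?exprnN -?exprnP ?normfV normrX sym_norm expr1n //.
by rewrite invr1.
Qed.

Lemma sym_w0 : w != 0.
Proof. exact/unimodular_neq0/sym_norm. Qed.

Lemma sym_conjw n : Num.conj (w ^ n) = w ^ (- n).
Proof. by rewrite unimodular_conj ?sym_wn // invr_expz. Qed.

Lemma sym_dotw n x : d (w ^ n *: x) (w ^ n *: x) = d x x.
Proof. by rewrite dnormZ sym_wn expr1n mul1r. Qed.

Definition laurent_fun (f : int -> E) n := w ^ n *: (A (f n) + B (f (n - 1))).
(** The adjoint is split in two. In the B part, f n occurs in the entry n + 1 of the image, whence
    the index and the weight w^(n + 1). *)
Definition laurent_adjA (g : int -> E) n := A' (w ^ (- n) *: g n).
Definition laurent_adjB (g : int -> E) n := B' (w ^ (- (n + 1)) *: g (n + 1)).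

Lemma laurent_sqsum f : f \in sqsum d -> laurent_fun f \in sqsum d.
Proof.
move=> fs; apply: (@sqsum_dom _ _ _ _ ((fun n => A (f n)) + (fun n => B (f (n - 1))))).
  apply: rpredD.
    by apply: sqsum_dom fs _ => n; rewrite -[leRHS]sym_normD lerDl dnorm_ge0.
  apply: sqsum_dom (sqsum_shift fs) _ => n.
  by rewrite -[leRHS]sym_normD lerDr dnorm_ge0.
by move=> n; rewrite sym_dotw.
Qed.

Lemma laurent_adjA_sqsum g : g \in sqsum d -> laurent_adjA g \in sqsum d.
Proof.
move=> gs; apply: sqsum_dom gs _ => n.
by rewrite -[leRHS](sym_dotw (- n)) -[leRHS]sym_normD' lerDl dnorm_ge0.
Qed.

Lemma laurent_adjB_sqsum g : g \in sqsum d -> laurent_adjB g \in sqsum d.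
Proof.
move=> gs; apply: sqsum_dom (sqsum_shiftV gs) _ => n.
by rewrite -[leRHS](sym_dotw (- (n + 1))) -[leRHS]sym_normD' lerDr dnorm_ge0.
Qed.

Definition laurent (f : ell2 d) : ell2 d := Ell2 (laurent_sqsum (ell2_valP f)).

Definition laurent_adj (g : ell2 d) : ell2 d :=
  Ell2 (laurent_adjA_sqsum (ell2_valP g)) + Ell2 (laurent_adjB_sqsum (ell2_valP g)).

Lemma laurentE (f : ell2 d) n : laurent f n = w ^ n *: (A (f n) + B (f (n - 1))).
Proof. by []. Qed.

Lemma laurent_linear : linear laurent.
Proof.
move=> a f g; apply: ell2P => n.
rewrite ell2D ell2Z !laurentE !ell2D !ell2Z !linearP /= addrACA -(scalerDr a) [LHS]scalerDr.
by congr (_ + _); rewrite !scalerA mulrC.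
Qed.

Lemma laurent_adj_linear : linear laurent_adj.
Proof.
move=> a f g; apply: ell2P => n; rewrite /= /laurent_adjA /laurent_adjB.
have Z (X : {linear E -> E}) b (x y : E) :
    X (b *: (a *: x + y)) = a *: X (b *: x) + X (b *: y).
  by rewrite scalerDr linearD /= scalerA mulrC -scalerA linearZ.
rewrite [LHS](_ : _ = laurent_adjA (a *: f + g) n + laurent_adjB (a *: f + g) n) //.
rewrite /laurent_adjA /laurent_adjB !ell2D !ell2Z !Z addrACA -scalerDr.
by [].
Qed.

HB.instance Definition _ := GRing.isLinear.Build _ _ _ _ laurent laurent_linear.
HB.instance Definition _ :=
  GRing.isLinear.Build _ _ _ _ laurent_adj laurent_adj_linear.

Lemma laurent_adjE (g : ell2 d) n : laurent_adj g n =
  A' (w ^ (- n) *: g n) + B' (w ^ (- (n + 1)) *: g (n + 1)).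
Proof. by []. Qed.

Lemma laurent_is_adjoint :
  is_adjoint (@ell2_dot R E d) (@ell2_dot R E d) laurent laurent_adj.
Proof.
move=> f g; rewrite linearDr /= /ell2_dot.
(* Replacing n by n - 1 in the B part makes both parts pair with the same entry g n. *)
have [gBs <-] :=
  zsummable_shift (ell2_summable f (Ell2 (laurent_adjB_sqsum (ell2_valP g)))).
rewrite -(proj2 (zsummableD (ell2_summable _ _) gBs)).
apply: zsum_eq => n; rewrite laurentE /= /laurent_adjA /laurent_adjB subrK.
rewrite linearZl_LR linearDl /= sym_adjA sym_adjB !linearZ /=.
by rewrite sym_conjw opprK mulrDr.
Qed.

Lemma laurentK : cancel laurent laurent_adj.
Proof.
move=> f; apply: ell2P => n.
rewrite laurent_adjE !laurentE addrK !scalerA -!expfzDr ?sym_w0 //.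
rewrite !addNr !expr0z !scale1r !linearD /= sym_A'B sym_B'A addr0 add0r.
exact: sym_A'A.
Qed.

Lemma laurent_adjK : cancel laurent_adj laurent.
Proof.
move=> f; apply: ell2P => n.
rewrite laurentE !laurent_adjE subrK (linearD A) (linearD B) /=.
rewrite sym_AB' sym_BA' addr0 add0r.
by rewrite sym_AA' scalerA -expfzDr ?sym_w0 // subrr expr0z scale1r.
Qed.

End Laurent.

Section LaurentCommutation.
Variables (R : realType) (E : lmodType R[i]) (d : {dot E for Num.conj}).

(** The factor 1 / w_t appears because the inner operator has weight w_t^(n - 1) at the index n -
    1. *)
Lemma laurent2E (s t : symbol d) (f : ell2 d) n :
  laurent s (laurent t f) n = (symw s ^ n * symw t ^ n) *:
    (symA s (symA t (f n)) +
     (symA s (symB t (f (n - 1))) + (symw t)^-1 *: symB s (symA t (f (n - 1)))) +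
     (symw t)^-1 *: symB s (symB t (f (n - 1 - 1)))).
Proof.
rewrite !laurentE -scalerA; congr (_ *: _).
rewrite (expfzDr _ _ (sym_w0 t)) exprN1 -!scalerA !linearZ /= !linearD /=.
by rewrite !addrA.
Qed.

(** The three hypotheses compare the coefficients of f n, f (n - 2) and f (n - 1) in the two
    products. *)
Lemma laurent_qcomm (s t : symbol d) (r : R[i]) :
  (forall x, symA s (symA t x) = r *: symA t (symA s x)) ->
  (forall x, (symw t)^-1 *: symB s (symB t x) = (r / symw s) *: symB t (symB s x)) ->
  (forall x, symA s (symB t x) + (symw t)^-1 *: symB s (symA t x) =
    r *: (symA t (symB s x) + (symw s)^-1 *: symB t (symA s x))) ->
  forall f, laurent s (laurent t f) = r *: laurent t (laurent s f).
Proof.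
move=> hA hB hAB f; apply: ell2P => n.
rewrite ell2Z !laurent2E hA hB hAB -[(r / _) *: _]scalerA -!(scalerDr r).
by rewrite !(scalerA _ r) scalerA mulrC [symw s ^ n * _]mulrC.
Qed.

End LaurentCommutation.

(** * Co-extensions and their dilations *)

Section CoDilation.
Variable R : realType.
Local Notation C := R[i].

Definition adjmx (M : 'M[C]_2) : 'M[C]_2 := map_mx Num.conj M^T.

Lemma adjmxDZ (M N : 'M[C]_2) a : adjmx (M + a *: N) = adjmx M + Num.conj a *: adjmx N.
Proof. by apply/matrixP => i j; rewrite !mxE rmorphD rmorphM. Qed.

Section Frame.
Variables (E : lmodType C) (d : {dot E for Num.conj}) (V : {linear 'cV[C]_2 -> E}).
Variable P : E -> Prop.

(* Only the vectors in [P] (such as the sequences supported in n >= 0) are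
   required to satisfy V^* U f = M V^* f.  As [P] contains the range of [V] and is
   invariant under the operators U_i, this suffices to compress all monomials. *)
Definition co_frame : Prop :=
  [/\ dot_complete d, forall x y, d (V x) (V y) = eucl_dot x y, forall x, P (V x)
    & forall a x y, P x -> P y -> P (a *: x + y)].

(** The relation V^* U f = M V^* f is tested against x, so that no adjoint of V has to be named. *)
Definition compresses (U : E -> E) (M : 'M[C]_2) : Prop :=
  (forall f, P f -> P (U f)) /\
  (forall f x, P f -> d (U f) (V x) = d f (V (adjmx M *m x))).

Definition unitary_pair (U U' : E -> E) : Prop :=
  [/\ is_adjoint d d U U', cancel U U' & cancel U' U].

End Frame.

(** A bare inner product space is used instead of a packed Hilbert space, so that the construction
    can be iterated with [ell2 d] in place of E. *)
Definition co_dilation k (q : 'I_k -> 'I_k -> C) (T : 'I_k -> 'M[C]_2) : Prop :=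
  exists (E : lmodType C) (d : {dot E for Num.conj}) (U U' : 'I_k -> {linear E -> E})
    (V : {linear 'cV[C]_2 -> E}) (P : E -> Prop),
  [/\ co_frame d V P, forall i, unitary_pair d (U i) (U' i),
      forall i j : 'I_k, (i < j)%N -> forall x, U i (U j x) = q i j *: U j (U i x)
    & forall i, compresses d V P (U i) (T i)].

(** * Compression of Laurent operators by Hardy space kernels *)

Section Hardy.
Variables (E : lmodType C) (d : {dot E for Num.conj}) (V : {linear 'cV[C]_2 -> E}).
Variables (P : E -> Prop) (c : C).
Hypothesis fr : co_frame d V P.
Hypothesis c1 : `|c| < 1.

Let sc : C := sqrtC (1 - `|c| ^+ 2).

(** Taylor coefficients of the normalized Szego kernel at c. Pairing with it evaluates a power
    series at c, up to the factor [sc]. *)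
Definition hardy_coef n : C := sc * Num.conj c ^+ n.

Lemma conj_hardy_coef n : Num.conj (hardy_coef n) = sc * c ^+ n.
Proof.
rewrite /hardy_coef rmorphM rmorphXn /= conjCK; congr (_ * _).
rewrite (CrealP _) // ger0_real // sqrtC_ge0 subr_ge0.
by rewrite exprn_ile1 // ltW.
Qed.

Lemma hardy_coef_norm : csummable (fun n => Num.conj (hardy_coef n) * hardy_coef n) /\
  csum (fun n => Num.conj (hardy_coef n) * hardy_coef n) = 1.
Proof.
pose t := complex.Re (`|c| ^+ 2).
have tE : `|c| ^+ 2 = t%:C by rewrite RRe_real // rpredX // normr_real.
have t1 : `|t| < 1.
  rewrite ger0_norm; last by rewrite -ler0c -tE exprn_ge0.
  by rewrite -ltcR -tE expr_lt1.
have -> : (fun n => Num.conj (hardy_coef n) * hardy_coef n) =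
    (fun n => ((1 - t) * t ^+ n)%:C).
  apply/funext => n; rewrite conj_hardy_coef /hardy_coef mulrACA -expr2 sqrtCK.
  by rewrite -exprMn -normCK rmorphM rmorphB rmorphXn /= -tE.
exact: csum_geometric.
Qed.

Definition hardy_fun (x : 'cV[C]_2) (n : int) : E :=
  if n is Posz m then V (hardy_coef m *: x) else 0.

Lemma hardy_VZ a x : V (a *: x) = a *: V x.
Proof. by rewrite linearZ. Qed.

Lemma hardy_dot x y m : d (V (hardy_coef m *: x)) (V (hardy_coef m *: y)) =
  eucl_dot x y * (Num.conj (hardy_coef m) * hardy_coef m).
Proof.
have [_ VI _ _] := fr.
rewrite !hardy_VZ linearZl_LR linearZr_LR /= VI.
by rewrite mulrA mulrC; congr (_ * _); rewrite mulrC.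
Qed.

Lemma hardy_sqsum x : hardy_fun x \in sqsum d.
Proof.
apply/sqsumP/zsummable_pos => [n|]; first exact: linear0l.
have [h _] := csummableZ (eucl_dot x x) (proj1 hardy_coef_norm).
by under eq_fun => n do rewrite /= hardy_dot.
Qed.

Definition hardy (x : 'cV[C]_2) : ell2 d := Ell2 (hardy_sqsum x).

Lemma hardy_linear : linear hardy.
Proof.
move=> a x y; apply: ell2P => -[] n; rewrite ell2D ell2Z /=.
  by rewrite !hardy_VZ linearP /= !scalerDr !scalerA [_ * a]mulrC.
by rewrite scaler0 addr0.
Qed.

HB.instance Definition _ := GRing.isLinear.Build _ _ _ _ hardy hardy_linear.

Definition hardy_dom (f : ell2 d) : Prop :=
  (forall n, f (Negz n) = 0) /\ (forall n, P (f n)).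

Lemma co_frame0 : P 0.
Proof. by have [_ _ PV _] := fr; rewrite -(linear0 V). Qed.

Lemma hardy_frame : co_frame (@ell2_dot R E d : {dot ell2 d for Num.conj}) hardy hardy_dom.
Proof.
have [dc VI PV PL] := fr; split.
- exact: ell2_complete.
- move=> x y; rewrite /= /ell2_dot zsum_pos => [|n]; last exact: linear0l.
  under eq_fun => n do rewrite /= hardy_dot.
  by rewrite (proj2 (csummableZ _ (proj1 hardy_coef_norm))) (proj2 hardy_coef_norm) mulr1.
- by move=> x; split=> // -[] n /=; [exact: PV|exact: co_frame0].
- move=> a f g [f0 fP] [g0 gP]; split=> n; rewrite ell2D ell2Z.
    by rewrite f0 g0 scaler0 addr0.
  exact: PL.
Qed.

Lemma hardy_dotE (f : ell2 d) x : csummable (fun n => d (f n%:Z) (hardy x n%:Z)) /\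
  ell2_dot f (hardy x) = csum (fun n => d (f n%:Z) (hardy x n%:Z)).
Proof.
split; first by have [] := ell2_summable f (hardy x).
by rewrite /ell2_dot zsum_pos // => n; exact: linear0r.
Qed.

(** V^* maps f to a multiple of the sum of c^n V^* f_n, that is, evaluates at z = c, and so turns A
    + z B into MA + c MB. The weights disappear because w c = c gives w^n c^n = c^n. *)
Lemma hardy_compresses (s : symbol d) (MA MB : 'M[C]_2) :
  compresses d V P (symA s) MA -> compresses d V P (symB s) MB -> symw s * c = c ->
  compresses (@ell2_dot R E d) hardy hardy_dom (laurent s) (MA + c *: MB).
Proof.
move=> [PA cA] [PB cB] wc; have [_ _ PV PL] := fr; split=> [f [f0 fP]|f x [f0 fP]].
  split=> n; rewrite laurentE.
    (* At a negative index only entries with negative indices enter. *)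
    by rewrite [_ - 1](_ : _ = Negz n.+1) ?f0 ?linear0 ?addr0 ?scaler0 //;
      rewrite !NegzE -opprD -[in RHS]addn1 PoszD.
  rewrite -[_ *: _]addr0; apply: (PL); last exact: co_frame0.
  by rewrite -[symA s _]scale1r; apply: PL; [exact: PA|exact: PB].
have wcn n : symw s ^+ n * c ^+ n = c ^+ n by rewrite -exprMn wc.
change (ell2_dot (laurent s f) (hardy x) =
  ell2_dot f (hardy (adjmx (MA + c *: MB) *m x))).
have -> : adjmx (MA + c *: MB) *m x = Num.conj c *: (adjmx MB *m x) + adjmx MA *m x.
  by rewrite adjmxDZ mulmxDl -scalemxAl addrC.
rewrite hardy_linear (ell2_dot_bilinear d).2 /= conjCK.
have [sA ->] := hardy_dotE f (adjmx MA *m x).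
have [sB ->] := hardy_dotE f (adjmx MB *m x).
have [_ ->] := hardy_dotE (laurent s f) x.
(* The B part of the pairing. Its term at n = 0 involves f (-1) = 0, so the sum starts at 1, and the
   shift by one index produces the factor c. *)
pose v (n : nat) := d (f (n%:Z - 1)) (V (hardy_coef n *: (adjmx MB *m x))).
have vS : (fun n => v n.+1) = (fun n => c * d (f n%:Z) (hardy (adjmx MB *m x) n%:Z)).
  apply/funext => n; rewrite /v -addn1 PoszD addrK /=.
  rewrite !hardy_VZ !linearZr_LR /= !conj_hardy_coef addn1 exprS.
  by rewrite -[_ *: _]/(_ * _); ring.
have [scB ecB] := csummableZ c sB.
have [sv ev] : csummable v /\ csum v = c * csum (fun n => d (f n%:Z) (hardy (adjmx MB *m x) n%:Z)).
  have [|sv ev] := @csummable_recl _ v; first by rewrite vS.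
  split=> //; rewrite ev vS ecB /v sub0r (_ : -1 = Negz 0) // f0.
  by rewrite linear0l add0r.
rewrite -ev -(proj2 (csummableD sv sA)); congr csum; apply/funext => n.
rewrite laurentE /v /= !hardy_VZ !linearZr_LR linearZl_LR linearDl /= !conj_hardy_coef.
rewrite cA // cB // -exprnP.
by rewrite -[in RHS](wcn n); ring.
Qed.

End Hardy.

(** * Dilation of symbols evaluated at a point of the closed disc *)

Section SymbolDilation.
Variables (k : nat) (q : 'I_k -> 'I_k -> C).
Variables (E : lmodType C) (d : {dot E for Num.conj}) (V : {linear 'cV[C]_2 -> E}).
Variables (P : E -> Prop) (c : C) (s : 'I_k -> symbol d) (MA MB : 'I_k -> 'M[C]_2).
Hypothesis fr : co_frame d V P.
Hypothesis cA : forall i, compresses d V P (symA (s i)) (MA i).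
Hypothesis cB : forall i, compresses d V P (symB (s i)) (MB i).
Hypothesis wc : forall i, symw (s i) * c = c.
Hypothesis qA : forall i j : 'I_k, (i < j)%N -> forall x,
  symA (s i) (symA (s j) x) = q i j *: symA (s j) (symA (s i) x).
Hypothesis qB : forall i j : 'I_k, (i < j)%N -> forall x,
  (symw (s j))^-1 *: symB (s i) (symB (s j) x) =
  (q i j / symw (s i)) *: symB (s j) (symB (s i) x).
Hypothesis qAB : forall i j : 'I_k, (i < j)%N -> forall x,
  symA (s i) (symB (s j) x) + (symw (s j))^-1 *: symB (s i) (symA (s j) x) =
  q i j *: (symA (s j) (symB (s i) x) + (symw (s i))^-1 *: symB (s j) (symA (s i) x)).

Lemma symbol_dilation_lt1 : `|c| < 1 -> co_dilation q (fun i => MA i + c *: MB i).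
Proof.
move=> c1; exists (ell2 d), (@ell2_dot R E d : {dot ell2 d for Num.conj}).
exists (fun i => laurent (s i) : {linear ell2 d -> ell2 d}).
exists (fun i => laurent_adj (s i) : {linear ell2 d -> ell2 d}).
exists (hardy fr c1 : {linear _ -> _}), (hardy_dom P).
split; first exact: hardy_frame.
- move=> i; split; [exact: laurent_is_adjoint|exact: laurentK|exact: laurent_adjK].
- by move=> i j ij f; apply: laurent_qcomm; [exact: qA|exact: qB|exact: qAB].
- by move=> i; exact: hardy_compresses.
Qed.

Let ev (i : 'I_k) : E -> E := (symA (s i) : E -> E) \+ (c \*: symB (s i)).
Let ev' (i : 'I_k) : E -> E := (symA' (s i) : E -> E) \+ (Num.conj c \*: symB' (s i)).

(* If |c| = 1 then w = 1 and A + c B itself is unitary on E, so that no passage to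
   sequences is needed. *)
Lemma symbol_dilation_eq1 : `|c| = 1 -> co_dilation q (fun i => MA i + c *: MB i).
Proof.
move=> c1; have c0 : c != 0 by exact: unimodular_neq0.
have w1 i : symw (s i) = 1 by apply: (mulIf c0); rewrite wc mul1r.
have cc : c * Num.conj c = 1 by rewrite -normCK c1 expr1n.
exists E, d, (fun i => ev i : {linear E -> E}), (fun i => ev' i : {linear E -> E}), V, P.
have [dc VI PV PL] := fr; split=> //.
- move=> i; split.
  + move=> x y; rewrite /ev /ev' /= linearDl linearDr linearZl_LR linearZr_LR /= conjCK.
    by rewrite sym_adjA sym_adjB.
  + move=> x; rewrite /ev /ev' /= !linearD !linearZ /= sym_A'B sym_B'A !scaler0.
    by rewrite addr0 add0r scalerA cc scale1r sym_A'A.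
  + move=> x; rewrite /ev /ev' /= !linearD !linearZ /= sym_AB' sym_BA' !scaler0.
    by rewrite addr0 add0r scalerA mulrC cc scale1r sym_AA'.
- move=> i j ij x; rewrite /ev /=.
  have hB := qB ij x; have hAB := qAB ij x.
  rewrite !w1 invr1 !scale1r mulr1 in hB hAB.
  have evE i' j' : symA (s i') (symA (s j') x + c *: symB (s j') x) +
      c *: symB (s i') (symA (s j') x + c *: symB (s j') x) =
      symA (s i') (symA (s j') x) +
      c *: (symA (s i') (symB (s j') x) + symB (s i') (symA (s j') x)) +
      (c * c) *: symB (s i') (symB (s j') x).
    by rewrite !linearD !linearZ /= scalerA -!addrA.
  rewrite !evE (qA ij) hB hAB !scalerDr.
  by rewrite !scalerA ![_ * q i j]mulrC.
- move=> i; have [PA eA] := cA i; have [PB eB] := cB i; split=> [f Pf|f x Pf].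
    by rewrite /ev /= addrC; apply: PL; [exact: PB|exact: PA].
  rewrite /ev /= adjmxDZ mulmxDl -scalemxAl linearDl linearZl_LR /= eA // eB //.
  by rewrite linearD linearZ linearDr linearZr_LR /= conjCK.
Qed.

Theorem symbol_dilation : `|c| <= 1 -> co_dilation q (fun i => MA i + c *: MB i).
Proof.
rewrite le_eqVlt => /orP[/eqP|]; first exact: symbol_dilation_eq1.
exact: symbol_dilation_lt1.
Qed.

End SymbolDilation.

End CoDilation.

(** * Euclidean space and passage to Hilbert spaces *)

Section Euclid.
Variable R : realType.
Local Notation C := R[i].
Local Notation E := 'cV[C]_2.
Implicit Types (x y : E) (M : 'M[C]_2).

Lemma eucl_dotE n (x y : 'cV[C]_n) :
  eucl_dot x y = \sum_i x i 0 * Num.conj (y i 0).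
Proof. by rewrite /eucl_dot dotmxE mxE; apply: eq_bigr => i _; rewrite !mxE. Qed.

Lemma eucl_dot_bilinear n : bilinear_for
  (GRing.Scale.Law.clone _ _ ( *%R ) _) (GRing.Scale.Law.clone _ _ (Num.conj \; *%R) _)
  (@eucl_dot R n).
Proof.
split=> [y a u v|x a u v] /=; rewrite !eucl_dotE mulr_sumr -big_split /=.
  by apply: eq_bigr => i _; rewrite !mxE mulrDl mulrA.
by apply: eq_bigr => i _; rewrite !mxE rmorphD rmorphM mulrDr mulrCA.
Qed.

HB.instance Definition _ n := bilinear_isBilinear.Build C 'cV[C]_n 'cV[C]_n C
  _ _ (@eucl_dot R n) (@eucl_dot_bilinear n).

Lemma eucl_dot_herm n (x y : 'cV[C]_n) :
  eucl_dot x y = (-1) ^+ false * Num.conj (eucl_dot y x).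
Proof. by rewrite /eucl_dot hermC. Qed.

HB.instance Definition _ n := isHermitianSesquilinear.Build C 'cV[C]_n false
  Num.conj (@eucl_dot R n) (@eucl_dot_herm n).

Lemma eucl_dot_gt0 n (x : 'cV[C]_n) : x != 0 -> 0 < eucl_dot x x.
Proof. by move=> x0; rewrite /eucl_dot dnorm_gt0 trmx_eq0. Qed.

HB.instance Definition _ n := isDotProduct.Build C 'cV[C]_n (@eucl_dot R n)
  (@eucl_dot_gt0 n).

Lemma eucl_dot_adj M x y : eucl_dot (M *m x) y = eucl_dot x (adjmx M *m y).
Proof.
rewrite /eucl_dot /adjmx !dotmxE trmx_mul; congr (fun_of_matrix _ 0 0).
by rewrite -mulmxA !trmxK map_mxM /= map_mxCK.
Qed.

Lemma eucl_complete : dot_complete (@eucl_dot R 2 : {dot E for Num.conj}).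
Proof.
move=> F FF Fc.
(* To be applied with phi the real and imaginary parts of the two entries, which reduces the claim
   to completeness of the reals. *)
have coord (phi : E -> R) : (forall x y, ((phi x - phi y) ^+ 2)%:C <= eucl_dot (x - y) (x - y)) ->
    exists l : R, forall e : R, 0 < e -> F [set y | (l - phi y) ^+ 2 < e]%classic.
  move=> phiE; have FG : ProperFilter (phi @ F)%classic by exact: fmap_proper_filter.
  have : cauchy (phi @ F)%classic.
    apply/cauchyP => e e0.
    have [|x Fx] := Fc (e ^+ 2)%:C; first by rewrite (ltcR 0) exprn_gt0.
    exists (phi x); rewrite /fmap /=; apply: filterS Fx => y /= xy.
    rewrite -ball_normE /= -ltr_sqr ?nnegrE ?(ltW e0) //.
    by rewrite real_normK ?num_real // -ltcR; apply: le_lt_trans xy.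
  move=> /R_complete /cvg_ex[l lF]; exists l => e e0.
  have s0 : 0 < Num.sqrt e by rewrite sqrtr_gt0.
  move/cvgrPdist_lt: lF => /(_ _ s0); rewrite /nbhs /=; apply: filterS => y /=.
  move=> h; rewrite -[ltRHS]sqr_sqrtr ?(ltW e0) // -real_normK ?num_real //.
  by rewrite ltr_sqr ?nnegrE ?sqrtr_ge0.
have nE x : eucl_dot x x = ((complex.Re (x 0 0)) ^+ 2 + (complex.Im (x 0 0)) ^+ 2 +
    ((complex.Re (x 1 0)) ^+ 2 + (complex.Im (x 1 0)) ^+ 2))%:C.
  rewrite eucl_dotE !big_ord_recl big_ord0 addr0 rmorphD /= !add_Re2_Im2 !normCK.
  by rewrite (_ : lift ord0 ord0 = 1) //; exact: val_inj.
have ReB (a b : C) : complex.Re (a - b) = complex.Re a - complex.Re b by exact: raddfB.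
have ImB (a b : C) : complex.Im (a - b) = complex.Im a - complex.Im b by exact: raddfB.
have [a aF] : exists l : R, forall e : R, 0 < e ->
    F [set y : E | (l - complex.Re (y 0 0)) ^+ 2 < e]%classic.
  by apply: coord => x y; rewrite nE !mxE !ReB lecR -addrA lerDl !addr_ge0 ?sqr_ge0.
have [b bF] : exists l : R, forall e : R, 0 < e ->
    F [set y : E | (l - complex.Im (y 0 0)) ^+ 2 < e]%classic.
  by apply: coord => x y; rewrite nE !mxE !ImB lecR [leRHS]addrAC lerDr !addr_ge0 ?sqr_ge0.
have [a' a'F] : exists l : R, forall e : R, 0 < e ->
    F [set y : E | (l - complex.Re (y 1 0)) ^+ 2 < e]%classic.
  by apply: coord => x y; rewrite nE !mxE !ReB lecR [leRHS]addrCA lerDl !addr_ge0 ?sqr_ge0.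
have [b' b'F] : exists l : R, forall e : R, 0 < e ->
    F [set y : E | (l - complex.Im (y 1 0)) ^+ 2 < e]%classic.
  by apply: coord => x y; rewrite nE !mxE !ImB lecR [leRHS]addrA lerDr !addr_ge0 ?sqr_ge0.
exists (\col_i if i == 0 then a +i* b else a' +i* b') => e e0.
have eE : e = (complex.Re e)%:C by rewrite RRe_real // ger0_real // ltW.
have e4 : 0 < complex.Re e / 4%:R by rewrite divr_gt0 // -?ltr0n // -(ltcR 0) -eE.
near=> y; rewrite /= nE !mxE /= !ReB !ImB /= eE ltcR.
have -> : complex.Re e = complex.Re e / 4%:R + complex.Re e / 4%:R +
    (complex.Re e / 4%:R + complex.Re e / 4%:R).
  by rewrite -!mulrDl -!mulr2n -mulrnA -[_ *+ _]mulr_natr mulfK // pnatr_eq0.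
by do 2!apply: ltrD; near: y; [exact: aF|exact: bF|exact: a'F|exact: b'F].
Unshelve. all: by end_near. Qed.

End Euclid.

Section ToHilbert.
Variables (R : realType) (k : nat).
Local Notation C := R[i].
Variables (q : 'I_k -> 'I_k -> C) (T : 'I_k -> 'M[C]_2).

Lemma co_dilation_unitary_dilation : unimodular_family q -> co_dilation q T ->
  has_q_unitary_dilation q T.
Proof.
move=> uq [E [d [U [U' [V [P [[dc VI PV PL] Uu Uq UT]]]]]]].
pose H : hilbertType R := hilbert_of_dot dc.
pose UH i : {linear H -> H} := HB.pack (U i : H -> H)
  (GRing.isLinear.Build C H H _ (U i : H -> H) (linearP (U i))).
pose UH' i : {linear H -> H} := HB.pack (U' i : H -> H)
  (GRing.isLinear.Build C H H _ (U' i : H -> H) (linearP (U' i))).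
pose VH : {linear 'cV[C]_2 -> H} := HB.pack (V : 'cV[C]_2 -> H)
  (GRing.isLinear.Build C _ H _ (V : 'cV[C]_2 -> H) (linearP V)).
pose e i : 'cV[C]_2 := delta_mx i 0.
(* The adjoint of V, given by coordinates since the domain is finite-dimensional. *)
pose Vs0 (y : H) : 'cV[C]_2 := \col_i d y (V (e i)).
have Vs0_lin : linear Vs0.
  by move=> a y z; apply/colP => i; rewrite !mxE linearPl.
pose Vs : {linear H -> 'cV[C]_2} := HB.pack Vs0
  (GRing.isLinear.Build C H _ _ Vs0 Vs0_lin).
have xE (x : 'cV[C]_2) : x = \sum_i x i 0 *: e i.
  apply/colP => i; rewrite summxE (bigD1 i) //= big1 => [|j ji].
    by rewrite !mxE !eqxx mulr1 addr0.
  by rewrite !mxE eq_sym (negbTE ji) mulr0.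
have VsT i f : P f -> Vs0 (U i f) = T i *m Vs0 f.
  move=> Pf; have [_ cT] := UT i; apply/colP => a; rewrite !mxE cT //.
  rewrite [adjmx _ *m _]xE linear_sum linear_sumr; apply: eq_bigr => b _.
  rewrite linearZ linearZr_LR /= !mxE (bigD1 a) //= big1 => [|j ja].
    by rewrite !mxE !eqxx mulr1 addr0 conjCK.
  by rewrite !mxE (negbTE ja) mulr0.
exists H, UH, VH, Vs; split.
- by split=> // i j ij x; exact: Uq.
- by move=> i; have [Ua UK UK'] := Uu i; exists (UH' i); split.
- move=> x; apply/eqP.
  rewrite -(@eqrXn2 _ 2) // ?ler0c ?sqrtr_ge0 //; apply/eqP.
  rewrite -hdot_norm /= [LHS]VI.
  have p0 : 0 <= eucl_dot x x by exact: dnorm_ge0.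
  have pE : eucl_dot x x = (complex.Re (eucl_dot x x))%:C by rewrite RRe_real // ger0_real.
  by rewrite -rmorphXn /= sqr_sqrtr -?pE // -ler0c -pE.
- move=> x y; change (d (V x) y = eucl_dot x (Vs0 y)).
  rewrite [in LHS](xE x) linear_sum linear_sumlz eucl_dotE; apply: eq_bigr => i _.
  by rewrite linearZ linearZl_LR /= !mxE; congr (_ * _); exact: dotC.
move=> m x.
have VsV z : Vs0 (V z) = z.
  apply/colP => i; rewrite mxE VI eucl_dotE (bigD1 i) //= big1 => [|j ji].
    by rewrite mxE !eqxx conjC1 mulr1 addr0.
  by rewrite mxE (negbTE ji) conjC0 mulr0.
(* Compression holds only on [P], so invariance of [P] has to be carried along in the induction on
   the factors of the monomial. *)
pose K (M : 'M[C]_2) (g : H -> H) :=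
  forall f, P f -> P (g f) /\ Vs0 (g f) = M *m Vs0 f.
have : K (mx_monomial T m) (op_monomial UH m).
  apply: (big_ind2 K) => [f Pf|M g N h KM KN f Pf|i _ f Pf].
  - by rewrite mul1mx.
  - have [Ph eh] := KN f Pf; have [Pg eg] := KM _ Ph.
    by rewrite /= eg eh mulmxA.
  - have [PU _] := UT i; elim: (m i) => [|n [IP IE]]; first by rewrite expr0 mul1mx.
    by split; [exact: PU|rewrite iterS [LHS]VsT // IE exprS mulmxA].
move=> /(_ (V x) (PV x))[_ KE].
by rewrite [RHS]KE VsV.
Qed.

End ToHilbert.

(** * Matrices of order two and permanence properties *)

Section Mx2.
Variable R : realType.
Local Notation C := R[i].
Implicit Types (a b c d : C) (M : 'M[C]_2).

Lemma ord2P (P : 'I_2 -> Prop) : P 0 -> P 1 -> forall i, P i.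
Proof.
move=> P0 P1 [[|[|//]] i2].
  by rewrite (_ : Ordinal i2 = 0) //; exact: val_inj.
by rewrite (_ : Ordinal i2 = 1) //; exact: val_inj.
Qed.

Lemma mx2P (M N : 'M[C]_2) : M 0 0 = N 0 0 -> M 0 1 = N 0 1 -> M 1 0 = N 1 0 ->
  M 1 1 = N 1 1 -> M = N.
Proof.
move=> e00 e01 e10 e11; apply/matrixP => i j; move: i j.
by apply: ord2P; apply: ord2P.
Qed.

Lemma mx2M a b c d a' b' c' d' : mx2 a b c d *m mx2 a' b' c' d' =
  mx2 (a * a' + b * c') (a * b' + b * d') (c * a' + d * c') (c * b' + d * d').
Proof.
by apply: mx2P; rewrite !mxE !big_ord_recl big_ord0 addr0 !mxE.
Qed.

Lemma mx2D a b c d a' b' c' d' : mx2 a b c d + mx2 a' b' c' d' =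
  mx2 (a + a') (b + b') (c + c') (d + d').
Proof. by apply: mx2P; rewrite !mxE. Qed.

Lemma mx2Z r a b c d : r *: mx2 a b c d = mx2 (r * a) (r * b) (r * c) (r * d).
Proof. by apply: mx2P; rewrite !mxE. Qed.

Lemma mx2_1 : mx2 1 0 0 1 = 1%:M :> 'M[C]_2.
Proof. by apply: mx2P; rewrite !mxE. Qed.

Lemma mx2_0 : mx2 0 0 0 0 = 0 :> 'M[C]_2.
Proof. by apply: mx2P; rewrite !mxE. Qed.

Lemma adjmx2 a b c d : adjmx (mx2 a b c d) =
  mx2 (Num.conj a) (Num.conj c) (Num.conj b) (Num.conj d).
Proof. by apply: mx2P; rewrite !mxE. Qed.

Lemma adjmxM (M N : 'M[C]_2) : adjmx (M *m N) = adjmx N *m adjmx M.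
Proof. by rewrite /adjmx trmx_mul map_mxM. Qed.

Lemma adjmxK (M : 'M[C]_2) : adjmx (adjmx M) = M.
Proof. by apply/matrixP => i j; rewrite !mxE conjCK. Qed.

End Mx2.

Section Permanence.
Variables (R : realType) (k : nat).
Local Notation C := R[i].
Variables (q : 'I_k -> 'I_k -> C).
Implicit Types (T : 'I_k -> 'M[C]_2).

Lemma co_dilation_eq T T' : T =1 T' -> co_dilation q T -> co_dilation q T'.
Proof. by move/funext => ->. Qed.

(** The change of basis is absorbed into the embedding, which becomes V W^*; the unitaries stay the
    same. *)
Lemma co_dilation_unitary T (W : 'M[C]_2) : W *m adjmx W = 1%:M ->
  co_dilation q (fun i => adjmx W *m T i *m W) -> co_dilation q T.
Proof.
move=> WW [E [d [U [U' [V [P [[dc VI PV PL] Uu Uq UT]]]]]]].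
pose VW0 x := V (adjmx W *m x).
have VWl : linear VW0 by move=> a x y; rewrite /VW0 mulmxDr -scalemxAr linearP.
pose VW : {linear 'cV[C]_2 -> E} := HB.pack VW0 (GRing.isLinear.Build C _ E _ VW0 VWl).
exists E, d, U, U', VW, P; split=> //.
- split=> // [x y|x]; last exact: PV.
  by rewrite [LHS]VI eucl_dot_adj adjmxK mulmxA WW mul1mx.
- move=> i; have [PU cU] := UT i; split=> // f x Pf.
  change (d (U i f) (V (adjmx W *m x)) = d f (V (adjmx W *m (adjmx (T i) *m x)))).
  by rewrite cU // !adjmxM adjmxK -!mulmxA [W *m _]mulmxA WW mul1mx.
Qed.

Section OneSymbol.
Variables (E : lmodType C) (d : {dot E for Num.conj}) (U U' : {linear E -> E}).
Hypothesis UU' : unitary_pair d U U'.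

Let zeroE : {linear E -> E} := \0.

(** The constant symbol U or the symbol z U, according to b. *)
Lemma unitary_symbol (b : bool) : exists s : symbol d,
  [/\ forall x, symA s x = if b then 0 else U x,
      forall x, symB s x = if b then U x else 0 & symw s = 1].
Proof.
have [Ua UK UK'] := UU'.
have za : is_adjoint d d zeroE zeroE by move=> x y; rewrite linear0l linear0r.
have n1 : `|1 : C| = 1 by exact: normr1.
have e1 x : U (U' x) + zeroE (zeroE x) = x by rewrite addr0 UK'.
have e2 x : U' (U x) + zeroE (zeroE x) = x by rewrite addr0 UK.
have e3 x : zeroE (zeroE x) + U (U' x) = x by rewrite add0r UK'.
have e4 x : zeroE (zeroE x) + U' (U x) = x by rewrite add0r UK.
have z1 x : U (zeroE x) = 0 by exact: linear0.
have z2 x : U' (zeroE x) = 0 by exact: linear0.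
have z3 x : zeroE (U x) = 0 by [].
have z4 x : zeroE (U' x) = 0 by [].
case: b.
  by exists (Symbol za Ua e3 e4 z4 z1 z3 z2 n1); split.
by exists (Symbol Ua za e1 e2 z1 z4 z2 z3 n1); split.
Qed.

End OneSymbol.

(** The symbols are z U_j in position j and U_i elsewhere. The scalar z commutes with everything, so
    the relations persist, and evaluation at z = c puts c in front of T_j only. *)
Lemma co_dilation_scale1 T c j : `|c| <= 1 -> co_dilation q T ->
  co_dilation q (fun i => if i == j then c *: T i else T i).
Proof.
move=> c1 [E [d [U [U' [V [P [fr Uu Uq UT]]]]]]].
have [_ _ PV _] := fr.
have P0 : P 0 by rewrite -(linear0 V).
have z0 : compresses d V P (\0 : {linear E -> E}) 0.
  split=> [f Pf|f x Pf] //=.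
  by rewrite linear0l (_ : adjmx 0 = 0) ?mul0mx ?linear0 ?linear0r //;
    apply/matrixP => a b; rewrite !mxE conjC0.
have [s sP] := choice (fun i => unitary_symbol (Uu i) (i == j)).
have sA i x : symA (s i) x = if i == j then 0 else U i x by have [] := sP i.
have sB i x : symB (s i) x = if i == j then U i x else 0 by have [] := sP i.
have U0 i : U i 0 = 0 by exact: linear0.
have sw i : symw (s i) = 1 by have [] := sP i.
apply: (@co_dilation_eq (fun i => (if i == j then 0 else T i) +
    c *: (if i == j then T i else 0))).
  by move=> i; case: ifP => _; rewrite ?add0r ?scaler0 ?addr0.
apply: (symbol_dilation (s := s) fr) => //.
- by move=> i; rewrite (funext (sA i)); case: ifP.
- by move=> i; rewrite (funext (sB i)); case: ifP.
- by move=> i; rewrite sw mul1r.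
- move=> i i' ii' x; rewrite !sA.
  by case: (i == j); case: (i' == j); rewrite ?U0 ?scaler0 //; exact: Uq.
- move=> i i' ii' x; rewrite !sB !sw !invr1 mulr1 scale1r.
  by case: (i == j); case: (i' == j); rewrite ?U0 ?scaler0 //; exact: Uq.
- move=> i i' ii' x; rewrite !sA !sB !sw !invr1 !scale1r.
  by case: (i == j); case: (i' == j);
    rewrite ?U0 ?addr0 ?add0r ?scaler0 //; exact: Uq.
Qed.

Lemma co_dilation_scale T (t : 'I_k -> C) : (forall i, `|t i| <= 1) ->
  co_dilation q T -> co_dilation q (fun i => t i *: T i).
Proof.
move=> t1 dT.
(* Induction on the number n of indices that have already been scaled. *)
suff H n : co_dilation q (fun i => (if (i < n)%N then t i else 1) *: T i).
  by apply: co_dilation_eq (H k) => i; rewrite ltn_ord.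
elim: n => [|n IH]; first by apply: co_dilation_eq dT => i; rewrite scale1r.
have [nk|kn] := ltnP n k; last first.
  apply: co_dilation_eq IH => i; have ik := leq_trans (ltn_ord i) kn.
  by rewrite ltnS ik (ltnW ik).
apply: co_dilation_eq (co_dilation_scale1 (Ordinal nk) (t1 (Ordinal nk)) IH) => i.
rewrite -val_eqE /= [in RHS]ltnS [in RHS]leq_eqVlt; case: eqP => [e|_] //=.
by rewrite e ltnn scale1r (_ : i = Ordinal nk) //; exact: val_inj.
Qed.

End Permanence.

(** * The model tuples *)

Section Model.
Variables (R : realType) (k : nat).
Local Notation C := R[i].
Local Notation eucl := (@eucl_dot R 2 : {dot 'cV[C]_2 for Num.conj}).

Lemma mx_is_adjoint (M : 'M[C]_2) : is_adjoint eucl eucl (mulmx M) (mulmx (adjmx M)).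
Proof. by move=> x y; exact: eucl_dot_adj. Qed.

(** The two mixed identities of a symbol missing from the hypotheses are the adjoints of the two
    that are given. *)
Lemma mx_symbol (A B : 'M[C]_2) (w : C) :
  A *m adjmx A + B *m adjmx B = 1%:M -> adjmx A *m A + adjmx B *m B = 1%:M ->
  A *m adjmx B = 0 -> adjmx A *m B = 0 -> `|w| = 1 ->
  exists s : symbol eucl, [/\ forall x, symA s x = A *m x, forall x, symB s x = B *m x
    & symw s = w].
Proof.
move=> AA A'A AB A'B w1.
have BA : B *m adjmx A = 0.
  by rewrite -[LHS]adjmxK adjmxM adjmxK AB; apply: mx2P; rewrite !mxE conjC0.
have B'A : adjmx B *m A = 0.
  by rewrite -[LHS]adjmxK adjmxM adjmxK A'B; apply: mx2P; rewrite !mxE conjC0.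
have z (M N : 'M[C]_2) : M *m N = 0 -> forall x : 'cV[C]_2, M *m (N *m x) = 0.
  by move=> MN x; rewrite mulmxA MN mul0mx.
have o (M N M' N' : 'M[C]_2) : M *m N + M' *m N' = 1%:M ->
    forall x : 'cV[C]_2, M *m (N *m x) + M' *m (N' *m x) = x.
  by move=> MN x; rewrite !mulmxA -mulmxDl MN mul1mx.
by exists (@Symbol _ _ eucl (mulmx A) (mulmx B) (mulmx (adjmx A)) (mulmx (adjmx B)) w
  (mx_is_adjoint A) (mx_is_adjoint B) (o _ _ _ _ AA) (o _ _ _ _ A'A)
  (z _ _ AB) (z _ _ BA) (z _ _ A'B) (z _ _ B'A) w1).
Qed.

(* The product of diag(1, u) and, if [eps], of the matrix with rows (0, rho) and
   (1, 0); [model_q] records the commutation relations of such products. *)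
Definition model (rho u : C) (eps : bool) : 'M[C]_2 :=
  if eps then mx2 0 rho u 0 else mx2 1 0 0 u.

Definition model_q (u : 'I_k -> C) (eps : 'I_k -> bool) (i j : 'I_k) : C :=
  (if eps j then u i else 1) * (if eps i then (u j)^-1 else 1).

Let simp := (@mulr0 C, @mul0r C, @mulr1 C, @mul1r C, @addr0 C, @add0r C).

(** [model] is [modelA] + rho [modelB]; the symbol has z in place of rho. With the weight u^2 of
    [model_symbol], the lifted relations hold irrespective of rho. *)
Let modelA (u : C) (eps : bool) : 'M[C]_2 := if eps then mx2 0 0 u 0 else mx2 1 0 0 u.
Let modelB (eps : bool) : 'M[C]_2 := if eps then mx2 0 1 0 0 else mx2 0 0 0 0.

Lemma model_symbol (u : C) (eps : bool) : `|u| = 1 ->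
  exists s : symbol eucl, [/\ forall x, symA s x = modelA u eps *m x,
    forall x, symB s x = modelB eps *m x & symw s = u ^+ 2].
Proof.
move=> u1; have u0 := unimodular_neq0 u1.
by apply: mx_symbol; rewrite ?normrX ?u1 ?expr1n // /modelA /modelB;
  case: eps; rewrite !adjmx2 ?conjC0 ?conjC1 ?unimodular_conj // !mx2M ?mx2D
    -?mx2_1 -?mx2_0 ?simp ?mulVf ?mulfV ?simp.
Qed.

Lemma model_co_dilation (rho : C) (u : 'I_k -> C) (eps : 'I_k -> bool) :
  `|rho| <= 1 -> (forall i, `|u i| = 1) -> (forall i, u i ^+ 2 * rho = rho) ->
  co_dilation (model_q u eps) (fun i => model rho (u i) (eps i)).
Proof.
move=> rho1 u1 urho; have u0 i := unimodular_neq0 (u1 i).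
have [s sP] := choice (fun i => model_symbol (eps i) (u1 i)).
have sA i x : symA (s i) x = modelA (u i) (eps i) *m x by have [] := sP i.
have sB i x : symB (s i) x = modelB (eps i) *m x by have [] := sP i.
have sw i : symw (s i) = u i ^+ 2 by have [] := sP i.
apply: (@co_dilation_eq _ _ _ (fun i => modelA (u i) (eps i) + rho *: modelB (eps i))).
  move=> i; rewrite /model /modelA /modelB.
  by case: (eps i); rewrite mx2Z mx2D ?mulr0 ?mulr1 ?addr0 ?add0r.
have fr : co_frame eucl (idfun : {linear 'cV[C]_2 -> 'cV[C]_2}) (fun=> True).
  by split=> //; exact: eucl_complete.
have cM (M : 'M[C]_2) : compresses eucl (idfun : {linear 'cV[C]_2 -> 'cV[C]_2})
    (fun=> True) (mulmx M) M.
  by split; [move=> f _|move=> f x _; exact: eucl_dot_adj].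
have zM (M N : 'M[C]_2) : M = N -> forall x : 'cV[C]_2, M *m x = N *m x by move=> ->.
apply: (symbol_dilation (s := s) fr _ _ _ _ _ _ rho1).
- by move=> i; rewrite (funext (sA i)).
- by move=> i; rewrite (funext (sB i)).
- by move=> i; rewrite sw.
- move=> i j _ x; rewrite !sA !mulmxA scalemxAl; apply: zM.
  move: (u0 i) (u0 j); rewrite /modelA /model_q => a0 b0.
  by case: (eps i); case: (eps j); rewrite !(mx2M, mx2Z) !simp; congr mx2;
    rewrite // ?mulrA ?mulVf // ?mul1r // mulrC.
- move=> i j _ x; rewrite !sB !sw !mulmxA !scalemxAl; apply: zM.
  by rewrite /modelB /model_q; case: (eps i); case: (eps j);
    rewrite !(mx2M, mx2Z) !simp.
- move=> i j _ x; rewrite !sA !sB !sw !mulmxA !scalemxAl -!mulmxDl scalemxAl; apply: zM.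
  move: (u0 i) (u0 j); rewrite /modelA /modelB /model_q => a0 b0.
  by case: (eps i); case: (eps j); rewrite !(mx2M, mx2Z, mx2D) !simp;
    congr mx2 => //; field; rewrite ?a0 ?b0.
Qed.

End Model.

(** * Normal form *)

Section OperatorNorm.
Variables (R : realType) (n : nat).
Local Notation C := R[i].
Implicit Types (x : 'cV[C]_n) (A : 'M[C]_n).

Lemma eucl_dot_sqr x : eucl_dot x x = \sum_i `|x i 0| ^+ 2.
Proof. by rewrite eucl_dotE; apply: eq_bigr => i _; rewrite normCK. Qed.

Lemma eucl_norm_sqr x : (eucl_norm x ^+ 2)%:C = eucl_dot x x.
Proof.
have p0 : 0 <= eucl_dot x x by exact: dnorm_ge0.
have pE : (complex.Re (eucl_dot x x))%:C = eucl_dot x x by rewrite RRe_real // ger0_real.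
by rewrite /eucl_norm sqr_sqrtr // -ler0c pE.
Qed.

Lemma eucl_norm_ge0 x : 0 <= eucl_norm x.
Proof. exact: sqrtr_ge0. Qed.

Lemma eucl_norm_le x (r : R) : 0 <= r -> (eucl_norm x <= r) = (eucl_dot x x <= (r ^+ 2)%:C).
Proof. by move=> r0; rewrite -eucl_norm_sqr lecR ler_sqr ?nnegrE ?eucl_norm_ge0. Qed.

Lemma coef_le_eucl_norm x i : eucl_norm x <= 1 -> `|x i 0| <= 1.
Proof.
rewrite eucl_norm_le // expr1n eucl_dot_sqr => x1.
rewrite -(@expr_le1 _ 2) //; apply: le_trans x1.
by rewrite (bigD1 i) //= lerDl sumr_ge0 // => j _; exact: exprn_ge0.
Qed.

Lemma opnorm_ge A x : eucl_norm x <= 1 -> eucl_norm (A *m x) <= opnorm A.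
Proof.
move=> x1; apply: ub_le_sup; last by exists x.
(* The sum of the squared absolute row sums bounds the set of squared norms, so the [sup] is a
   genuine upper bound. *)
pose K : C := \sum_i (\sum_j `|A i j|) ^+ 2.
have K0 : 0 <= K.
  by apply: sumr_ge0 => i _; rewrite exprn_ge0 // sumr_ge0.
have KE : K = (complex.Re K)%:C by rewrite RRe_real // ger0_real.
have RK0 : 0 <= complex.Re K by rewrite -ler0c -KE.
exists (Num.sqrt (complex.Re K)) => _ [y /= y1 <-].
rewrite eucl_norm_le ?sqrtr_ge0 // sqr_sqrtr // -KE eucl_dot_sqr.
apply: ler_sum => i _; rewrite ler_sqr ?nnegrE ?sumr_ge0 // mxE.
apply: le_trans (ler_norm_sum _ _ _) _; apply: ler_sum => j _.
by rewrite normrM ler_piMr // coef_le_eucl_norm.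
Qed.

Lemma contraction_entry A i j : mx_contraction A -> `|A i j| <= 1.
Proof.
move=> A1; pose e : 'cV[C]_n := delta_mx j 0.
have e1 : eucl_norm e <= 1.
  rewrite eucl_norm_le // expr1n eucl_dot_sqr (bigD1 j) //= big1 => [|a aj].
    by rewrite mxE !eqxx normr1 expr1n addr0.
  by rewrite mxE (negbTE aj) normr0 expr0n.
have -> : A i j = (A *m e) i 0.
  rewrite mxE (bigD1 j) //= big1 => [|a aj]; first by rewrite mxE !eqxx mulr1 addr0.
  by rewrite mxE (negbTE aj) mulr0.
by apply: coef_le_eucl_norm; apply: le_trans A1; exact: opnorm_ge.
Qed.

End OperatorNorm.

Section NormalForm.
Variables (R : realType) (k : nat).
Local Notation C := R[i].
Implicit Types (T : 'I_k -> 'M[C]_2) (q : 'I_k -> 'I_k -> C).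

Lemma mx2_inj (a b c d a' b' c' d' : C) : mx2 a b c d = mx2 a' b' c' d' ->
  [/\ a = a', b = b', c = c' & d = d'].
Proof.
move=> /matrixP E.
by split; [have := E 0 0|have := E 0 1|have := E 1 0|have := E 1 1]; rewrite !mxE.
Qed.

Lemma mx2_eta (M : 'M[C]_2) : mx2 (M 0 0) (M 0 1) (M 1 0) (M 1 1) = M.
Proof. by apply: mx2P; rewrite mxE. Qed.

Definition has_sub_dilation q T := exists qt : 'I_k -> 'I_k -> C,
  [/\ unimodular_family qt, family_sub1 qt q & co_dilation qt T].

(** Once the nonzero t_i are cancelled, one matrix entry of the relation between T_i and T_j
    identifies q_ij with [model_q], unless both are diagonal or both products vanish; there
    [model_q] is 1. *)
Lemma model_has_sub_dilation q T (rho : C) (t u : 'I_k -> C) (eps : 'I_k -> bool) :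
  q_commuting_mx q T -> `|rho| <= 1 ->
  (forall i, [/\ t i != 0, `|t i| <= 1, `|u i| = 1 & u i ^+ 2 * rho = rho]) ->
  (forall i, eps i -> rho = 0 -> u i = 1) ->
  (forall i, T i = t i *: model rho (u i) (eps i)) -> has_sub_dilation q T.
Proof.
move=> [qu qT] rho1 H ueps TE.
have t0 i : t i != 0 by have [] := H i.
have t1 i : `|t i| <= 1 by have [] := H i.
have u1 i : `|u i| = 1 by have [] := H i.
have urho i : u i ^+ 2 * rho = rho by have [] := H i.
have u0 i := unimodular_neq0 (u1 i).
exists (model_q u eps); split.
- move=> i j _; rewrite /model_q.
  by case: (eps i); case: (eps j); rewrite ?mul1r ?mulr1 ?normrM ?normfV ?u1 ?normr1
    ?invr1 ?mulr1 ?invfM ?invrK; split=> //; rewrite mulrC.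
- move=> i j ij; have := qT i j ij; rewrite !TE -!scalemxAl -!scalemxAr !scalerA.
  rewrite -mulrA [t j * t i]mulrC => E.
  have {}E : model rho (u i) (eps i) *m model rho (u j) (eps j) =
      q i j *: (model rho (u j) (eps j) *m model rho (u i) (eps i)).
    apply: (scalerI (mulf_neq0 (t0 i) (t0 j))); rewrite E scalerA.
    by congr (_ *: _); exact: mulrC.
  suff : model_q u eps i j = 1 \/ model_q u eps i j = q i j.
    by move=> [->|->]; [left|right; exists i, j].
  have ui := ueps i; have uj := ueps j.
  move: E; rewrite /model_q /model; move: ui uj; case: (eps i); case: (eps j) => ui uj.
  (* Both off-diagonal: for rho = 0 the products vanish and u = 1 gives the value 1; otherwise the
     lower right entries give u_i rho = q_ij u_j rho. *)
  + have [r0|r0] := eqVneq rho 0; first by rewrite ui // uj // invr1 mulr1; left.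
    rewrite !(mx2M, mx2Z) => /mx2_inj[_ _ _]; rewrite !mul0r !addr0 mulrA => e.
    by right; rewrite (mulIf r0 e) mulfK.
  + rewrite !(mx2M, mx2Z) => /mx2_inj[_ _ + _].
    rewrite !mul0r !addr0 !add0r !mulr1 mulrA => e; right; rewrite mul1r.
    by apply: (mulIf (u0 j)); apply: (mulIf (u0 i)); rewrite -e mulVf // mul1r.
  + rewrite !(mx2M, mx2Z) => /mx2_inj[_ _ + _].
    by rewrite !mul0r !addr0 !add0r !mulr1 => /(mulIf (u0 j)) ->; right.
  + by move=> _; left; rewrite mulr1.
- apply: (@co_dilation_eq _ _ _ (fun i => t i *: model rho (u i) (eps i))).
    by move=> i; rewrite TE.
  by apply: co_dilation_scale => //; exact: model_co_dilation.
Qed.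

Definition diagonal_type (M : 'M[C]_2) :=
  exists c f, [/\ `|c| = `|f|, c != 0 & M = mx2 c 0 0 f].

Definition antidiagonal_type (M : 'M[C]_2) :=
  exists d e, (d != 0 \/ e != 0) /\ M = mx2 0 d e 0.

(** The common shape of the three types; it is invariant under the exchange of the basis vectors. *)
Definition monomial_tuple T := forall i, diagonal_type (T i) \/ antidiagonal_type (T i).

Lemma q_commuting_pair q T : q_commuting_mx q T ->
  forall i j, exists r, T i *m T j = r *: (T j *m T i).
Proof.
move=> [qu qT] i j; have [ij|ji|/val_inj ->] := ltngtP i j.
- by exists (q i j); exact: qT.
- exists (q j i)^-1; rewrite (qT _ _ ji) scalerA mulVf ?scale1r //.
  by have [/unimodular_neq0] := qu _ _ ji.
- by exists 1; rewrite scale1r.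
Qed.

Lemma lower_has_sub_dilation q T (rho : C) : q_commuting_mx q T -> `|rho| <= 1 ->
  (forall i a b, `|T i a b| <= 1) -> monomial_tuple T ->
  (forall i d e, (d != 0 \/ e != 0) -> T i = mx2 0 d e 0 ->
    e != 0 /\ (d = rho * e \/ d = - (rho * e))) ->
  (rho != 0 -> exists j d e, [/\ d != 0, e != 0 & T j = mx2 0 d e 0]) ->
  has_sub_dilation q T.
Proof.
move=> qT rho1 T1 TM Toff rhoT.
(* The triple p consists of t, u and eps in the model form of T i. *)
have /choice[g gP] i : exists p : C * C * bool, [/\
    [/\ p.1.1 != 0, `|p.1.1| <= 1, `|p.1.2| = 1 & p.1.2 ^+ 2 * rho = rho],
    p.2 -> rho = 0 -> p.1.2 = 1 & T i = p.1.1 *: model rho p.1.2 p.2].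
  have [[c [f [cf c0 TE]]]|[d [e [de TE]]]] := TM i.
    exists (c, f / c, false); split=> //=; last first.
      by rewrite /model TE mx2Z !mulr0 mulr1 mulrC divfK.
    split=> //; first by have := T1 i 0 0; rewrite TE mxE.
      by rewrite normrM normfV cf divff // -cf normr_eq0.
    (* If rho is nonzero, the relation with an antidiagonal T j having two nonzero entries gives c =
       r f and f = r c, hence (f / c)^2 = 1. *)
    have [->|/rhoT[j [d [e [d0 e0 TjE]]]]] := eqVneq rho 0; first by rewrite mulr0.
    have [r] := q_commuting_pair qT i j.
    rewrite TE TjE !(mx2M, mx2Z) => /mx2_inj[_ + + _].
    rewrite !mul0r !addr0 !add0r => E1 E2.
    have {}E1 : c = r * f by apply: (mulIf d0); rewrite E1; ring.
    have {}E2 : f = r * c by apply: (mulIf e0); rewrite E2; ring.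
    have fc : f / c = r by rewrite E2 mulfK.
    have : r * r = 1 by apply: (mulIf c0); rewrite mul1r -mulrA -E2 -E1.
    by rewrite fc expr2 => ->; rewrite mul1r.
  have [e0 dE] := Toff i d e de TE.
  have e1 : `|e| <= 1 by have := T1 i 1 0; rewrite TE mxE.
  have [rho0|rho0] := eqVneq rho 0.
    exists (e, 1, true); split=> //=; first by split; rewrite ?normr1 ?expr1n ?mul1r.
    rewrite /model TE mx2Z !mulr0 mulr1 rho0 mulr0.
    by case: dE => ->; rewrite rho0 mul0r ?oppr0.
  have [dE'|dE'] := dE.
    exists (e, 1, true); split=> //=; first by split; rewrite ?normr1 ?expr1n ?mul1r.
    by rewrite /model TE mx2Z !mulr0 mulr1 dE' mulrC.
  (* The sign of d is moved to the lower entry by u = -1 and restored there by t = -e. *)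
  exists (- e, - 1, true); split=> //=.
  - by split; rewrite ?oppr_eq0 ?normrN ?normr1 // sqrrN expr1n mul1r.
  - by move=> _ r0; rewrite r0 eqxx in rho0.
  - by rewrite /model TE mx2Z !mulr0 mulrNN mulr1 dE' mulNr mulrC.
apply: (@model_has_sub_dilation q T rho (fun i => (g i).1.1) (fun i => (g i).1.2)
  (fun i => (g i).2)) => // i; by have [] := gP i.
Qed.

(** The three cases fix rho: it is d / e for an antidiagonal matrix whose lower entry dominates, and
    0 otherwise. The relations force the other antidiagonal matrices to fit this rho. *)
Lemma lower_monomial_has_sub_dilation q T : q_commuting_mx q T ->
  (forall i a b, `|T i a b| <= 1) -> monomial_tuple T ->
  [\/ exists i d e, [/\ d != 0, e != 0, `|d| <= `|e| & T i = mx2 0 d e 0],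
      exists i e, e != 0 /\ T i = mx2 0 0 e 0
    | forall i, diagonal_type (T i)] ->
  has_sub_dilation q T.
Proof.
move=> qT T1 TM.
case=> [[i [d [e [d0 e0 de TE]]]]|[i [e [e0 TE]]]|TD].
- have r0 : d / e != 0 by rewrite mulf_neq0 // invr_neq0.
  apply: (@lower_has_sub_dilation q T (d / e)) => //; last by exists i, d, e.
    by rewrite normrM normfV ler_pdivrMr ?normr_gt0 // mul1r.
  move=> j d' e' d'e' TE'.
  have [r] := q_commuting_pair qT i j.
  rewrite TE TE' !(mx2M, mx2Z) => /mx2_inj[+ _ _ +].
  rewrite !mul0r !addr0 !add0r => E1 E2.
  have d'0 : d' != 0.
    apply/eqP => d'0; move: E1 d'e'; rewrite d'0 mul0r mulr0 => /eqP.
    by rewrite mulf_eq0 (negbTE d0) /= => ->; rewrite eqxx; case.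
  have e'0 : e' != 0.
    apply/eqP => e'0; move: E2 d'e'; rewrite e'0 mul0r mulr0 => /eqP.
    by rewrite mulf_eq0 (negbTE e0) (negbTE d'0).
  (* The diagonal entries give d e' = r d' e and e d' = r e' d. Together they force r = 1 or r = -1,
     and the second gives d' = r rho e'. *)
  have rr : r ^+ 2 = 1.
    apply: (mulIf (mulf_neq0 d'0 e0)); rewrite mul1r [d' * e]mulrC {2}E2.
    by rewrite [e' * d]mulrC E1; ring.
  have d'E : d' = r * (d / e * e').
    apply: (mulIf e0); rewrite [LHS]mulrC E2 -!mulrA; congr (r * _).
    by rewrite [e' * e]mulrC mulKf // mulrC.
  split=> //; have /eqP := rr; rewrite sqrf_eq1 => /orP[/eqP r1|/eqP r1]; rewrite d'E r1.
    by left; rewrite mul1r.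
  by right; rewrite mulN1r.
- apply: (@lower_has_sub_dilation q T 0) => //; last by rewrite eqxx.
    by rewrite normr0.
  move=> j d' e' d'e' TE'.
  (* The upper left entries give d' e = 0, so every antidiagonal matrix is strictly lower
     triangular. *)
  have [r] := q_commuting_pair qT j i.
  rewrite TE TE' !(mx2M, mx2Z) => /mx2_inj[+ _ _ _].
  rewrite !mul0r !add0r mulr0 => /eqP; rewrite mulf_eq0 (negbTE e0) orbF => /eqP d'0.
  split; last by left.
  by case: d'e' => //; rewrite d'0 eqxx.
- apply: (@lower_has_sub_dilation q T 0) => //; last by rewrite eqxx.
    by rewrite normr0.
  move=> j d e de TE; have [c [f [_ c0]]] := TD j.
  by rewrite TE => /mx2_inj[/esym/eqP]; rewrite (negbTE c0).
Qed.

Let flip : 'M[C]_2 := mx2 0 1 1 0.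

Lemma flip_adj : adjmx flip = flip.
Proof. by rewrite /flip adjmx2 conjC0 conjC1. Qed.

Lemma flipK : flip *m flip = 1%:M.
Proof. by rewrite /flip mx2M !mulr0 !mul0r !mulr1 !addr0 !add0r mx2_1. Qed.

Lemma flip_conj a b c d : flip *m mx2 a b c d *m flip = mx2 d c b a.
Proof. by rewrite /flip !mx2M !mulr0 !mul0r !mulr1 !mul1r !addr0 !add0r. Qed.

Lemma flip_has_sub_dilation q T :
  has_sub_dilation q (fun i => flip *m T i *m flip) -> has_sub_dilation q T.
Proof.
move=> [qt [uqt qtq dT]]; exists qt; split=> //.
apply: (@co_dilation_unitary _ _ _ _ flip); first by rewrite flip_adj flipK.
by rewrite flip_adj.
Qed.

Lemma flip_q_commuting q T :
  q_commuting_mx q T -> q_commuting_mx q (fun i => flip *m T i *m flip).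
Proof.
move=> [qu qT]; split=> // i j ij.
have fM M N : flip *m M *m flip *m (flip *m N *m flip) = flip *m (M *m N) *m flip.
  by rewrite -!mulmxA [flip *m (flip *m _)]mulmxA flipK mul1mx.
by rewrite !fM qT // -scalemxAr -scalemxAl.
Qed.

(** If none of the three cases holds for the tuple itself, one of them holds after the exchange of
    the two basis vectors. *)
Lemma monomial_has_sub_dilation q T : q_commuting_mx q T ->
  (forall i a b, `|T i a b| <= 1) -> monomial_tuple T -> has_sub_dilation q T.
Proof.
move=> qT T1 TM.
have [L|nL] := pselect [\/ exists i d e, [/\ d != 0, e != 0, `|d| <= `|e| & T i = mx2 0 d e 0],
      exists i e, e != 0 /\ T i = mx2 0 0 e 0
    | forall i, diagonal_type (T i)].
  exact: lower_monomial_has_sub_dilation L.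
apply: flip_has_sub_dilation; apply: lower_monomial_has_sub_dilation.
- exact: flip_q_commuting.
- move=> i; apply: ord2P; apply: ord2P; rewrite -[T i]mx2_eta flip_conj mxE /=; exact: T1.
- move=> i; have [[c [f [cf c0 ->]]]|[d [e [de ->]]]] := TM i; rewrite flip_conj.
    left; exists f, c; split=> //.
    by rewrite -normr_eq0 -cf normr_eq0.
  by right; exists e, d; split=> //; case: de; [right|left].
(* A nonzero upper entry d becomes a lower entry after the flip; if e is nonzero too, then |e| <=
   |d|, as otherwise T i would already be in the first case. Without such a d, the tuple is diagonal
   or contains a strictly lower triangular matrix, which is excluded. *)
have [[i [d [e [d0 TE]]]]|nd] := pselect (exists i d e, d != 0 /\ T i = mx2 0 d e 0).
  have [e0|e0] := eqVneq e 0.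
    by constructor 2; exists i, d; rewrite TE flip_conj e0.
  constructor 1; exists i, e, d; rewrite TE flip_conj; split=> //.
  have [//|de] := real_leP (normr_real e) (normr_real d).
  by case: nL; constructor 1; exists i, d, e; split=> //; exact: ltW.
exfalso; apply: nL.
have [TD|/existsNP[i nTi]] := pselect (forall i, diagonal_type (T i)); first by constructor 3.
have [//|[d [e [de TE]]]] := TM i.
constructor 2; exists i, e.
have [d0|d0] := eqVneq d 0; last by case: nd; exists i, d, e.
by rewrite TE d0; split=> //; case: de; rewrite // d0 eqxx.
Qed.

End NormalForm.

(** * From the three types to the dilation *)

Section Main.
Variables (R : realType) (k : nat).
Local Notation C := R[i].
Variables (q : 'I_k.+1 -> 'I_k.+1 -> C) (S : 'I_k.+1 -> 'M[C]_2).
Hypothesis qS : q_commuting_mx q S.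

Lemma eta_setI (r : C) j : j != ord0 -> q ord0 j = r -> j \in eta_set S r.
Proof.
move=> j0 qr; rewrite inE -qr; apply/eqP; apply: (proj2 qS).
by rewrite lt0n.
Qed.

(** As q_1j takes one of the two values listed in the type, each j > 1 lies in one of the two
    eta-sets, where the shape of T_j is prescribed. *)
Lemma typed_monomial : type_I q S \/ type_II q S \/ type_III q S -> monomial_tuple S.
Proof.
case=> [[a [r [a0 [r1 _ _] S0 qr Sj]]]|[[a [r [a0 [r1 _ _] S0 qr Sj]]]|[a [a0 S0 qr Sj]]]] j;
  (have [->|j0] := eqVneq j ord0;
    [left; rewrite S0; eexists; eexists; split; [|exact: a0|by []];
      by rewrite ?normrM ?r1 ?mul1r ?normrN|
     have [S1 Sr] := Sj j j0; have [/(eta_setI j0)|/(eta_setI j0)] := qr j j0]).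
- by move=> /S1[c [f [cf c0 ->]]]; left; exists c, f; rewrite -normr_eq0 cf.
- by move=> /Sr[e [e0 ->]]; right; exists 0, e; split=> //; right.
- by move=> /S1[c [f [cf c0 ->]]]; left; exists c, f; rewrite -normr_eq0 cf.
- by move=> /Sr[d [d0 ->]]; right; exists d, 0; split=> //; left.
- by move=> /S1[c [c0 [->|->]]]; left; [exists c, c|exists c, (- c)]; rewrite ?normrN.
- by move=> /Sr[d [e [de ->]]]; right; exists d, e.
Qed.

End Main.

Theorem theorem4p1 (R : realType) (k : nat) (q : 'I_k.+1 -> 'I_k.+1 -> R[i])
    (T : 'I_k.+1 -> 'M[R[i]]_2)
    (T_qcomm : q_commuting_mx q T)
    (T_contr : forall i, mx_contraction (T i))
    (T_equiv : exists S : 'I_k.+1 -> 'M[R[i]]_2,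
       [/\ q_commuting_mx q S,
           forall i, mx_contraction (S i),
           unitarily_equivalent T S
         & type_I q S \/ type_II q S \/ type_III q S]) :
  exists qt : 'I_k.+1 -> 'I_k.+1 -> R[i],
    [/\ unimodular_family qt, family_sub1 qt q
      & has_q_unitary_dilation qt T].
Proof.
have [S [qS S1 [W Wu WT] Stype]] := T_equiv.
have [qt [uqt qtq dS]] := monomial_has_sub_dilation qS
  (fun i a b => contraction_entry a b (S1 i)) (typed_monomial qS Stype).
exists qt; split=> //; apply: co_dilation_unitary_dilation => //.
(* The dilation obtained for S is carried back to T through the unitary W. *)
apply: (co_dilation_unitary (W := W)); first exact/unitarymxP.
exact: co_dilation_eq dS.
Qed.
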